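(* Consider the Cahn--Hilliard system on the lattice $L$ (as defined in the context), assume $\#S=4$ and $\gamma_3>A\gamma_2^2$, where $$A=\frac{2}{9}\max\left[\left(\frac{1}{3|k_1^c|^2}+\frac{2}{|k_1^c-k_2^c|^2-|k_1^c|^2}+\frac{2}{|k_1^c+k_2^c|^2-|k_1^c|^2}\right),\ \frac{1}{|k_1^c|^2}\right],$$ so that for $\lambda>\lambda_0$ near $\lambda_0$ the system bifurcates to a local attractor $\Sigma_\lambda\approx S^3$. Then in the collapsed phase space $(r_1,r_2)$, the attractor $\Sigma_\lambda$ collapses to an arc $\Sigma_\lambda^r$ in the first quadrant, which contains the three fixed points $$p_1=\left(0,\sqrt{\tfrac{-\beta}{\xi}}\right),\qquad p_2=\left(\sqrt{\tfrac{-\beta}{\xi}},0\right),\qquad p_3=\left(\sqrt{\tfrac{-\beta}{\xi+\eta}},\sqrt{\tfrac{-\beta}{\xi+\eta}}\right)\ \ (\text{if }\xi^2\ne\eta^2).$$ For $j\in\{1,2,3\}$, writing $p_j=(r_1^{(j)},r_2^{(j)})$, the point $p_j$ generates a circle ($j=1,2$) or a torus ($j=3$) of steady states $(y_1,y_3)=(r_1^{(j)}e^{i\theta_1},r_2^{(j)}e^{i\theta_2})$, $\theta_1,\theta_2\in\mathbb{R}$, and these are all contained in $\Sigma_\lambda$.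
   Context: Setting. Let $l_1,l_2\in\mathbb{R}^2$ be linearly independent, $L=\{n_1l_1+n_2l_2:(n_1,n_2)\in\mathbb{Z}^2\}$, and let $k_1,k_2\in\mathbb{R}^2$ be given by $k_i\cdot l_j=2\pi\delta_{ij}$; the dual lattice is $L^*=\{n_1k_1+n_2k_2:(n_1,n_2)\in\mathbb{Z}^2\}$. Let $U$ be the parallelogram spanned by $l_1,l_2$. The (non-dimensional) Cahn--Hilliard problem for a real-valued $u(x,t)$ is $$u_t=-\Delta^2u-\lambda\Delta u+\Delta(\gamma_2u^2+\gamma_3u^3),\quad (x,t)\in\mathbb{R}^2\times\mathbb{R}^+,$$ $$u(x+l,t)=u(x,t)\ \ \forall l\in L,\qquad u(x,0)=\phi(x),\qquad \int_Uu(x,t)\,dx=0,$$ where $\lambda\in\mathbb{R}$ is the control parameter, $\gamma_2\in\mathbb{R}$ and $\gamma_3>0$, viewed as an evolution equation in $H=\{u\in L^2(U):\int_Uu\,dx=0\}$ with linear part $L_\lambda u=-\Delta^2u-\lambda\Delta u$ on $L$-periodic functions. Critical modes. $S$ is the set of $(n_1,n_2)\in\mathbb{Z}^2\setminus\{(0,0)\}$ for which $|n_1k_1+n_2k_2|$ is minimal among all nonzero vectors of $L^*$. When $\#S=4$, $S=\{\pm(n_1^c,n_2^c),\pm(n_3^c,n_4^c)\}$ and the critical vectors are $k_1^c=n_1^ck_1+n_2^ck_2$, $k_2^c=n_3^ck_1+n_4^ck_2$; $\lambda_0=|k_1^c|^2=|k_2^c|^2$. Reduced system. Near $(0,\lambda_0)$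 solutions on the center manifold are $u=y_1e_1+\overline{y_1}\,\overline{e_1}+y_3e_3+\overline{y_3}\,\overline{e_3}+\Phi$, with $e_1=e^{ik_1^c\cdot x}$, $e_3=e^{ik_2^c\cdot x}$, $y_1,y_3\in\mathbb{C}$, and $\Phi=o(|y|)$ the center manifold function (valued in the closed span of the noncritical modes). Set $\beta=\beta(\lambda)=-|k_1^c|^2(|k_1^c|^2-\lambda)$ and $$\xi=\frac{2\gamma_2^2-9|k_1^c|^2\gamma_3}{3},\qquad \eta=2|k_1^c|^2\left(\frac{2\gamma_2^2}{|k_1^c-k_2^c|^2-|k_1^c|^2}+\frac{2\gamma_2^2}{|k_1^c+k_2^c|^2-|k_1^c|^2}-3\gamma_3\right).$$ The leading-order reduced system on the center manifold is $$\dot y_1=\beta y_1+y_1(\xi|y_1|^2+\eta|y_3|^2),\qquad \dot y_3=\beta y_3+y_3(\eta|y_1|^2+\xi|y_3|^2)$$ (terms of order $o(|y|^3)+O(|y|^3|\beta|)$ being omitted), and the collapsed phase space is that of the radii $r_1=|y_1|$, $r_2=|y_3|$, governed by $\dot r_1=\beta r_1+r_1(\xi r_1^2+\eta r_2^2)$, $\dot r_2=\beta r_2+r_2(\eta r_1^2+\xi r_2^2)$. The attractor $\Sigma_\lambda$ (the set of transition states, homological to the sphere $S^3$, which is what $\Sigma_\lambda\approx S^3$ denotes), its fixed points and its steady states are described through this leading-order reduced system, a point of $\Sigma_\lambda$ being identified with its coordinates $(y_1,y_3)$. *)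

(* Defs.v *)
From HB Require Import structures.
From mathcomp Require Import all_boot all_order all_algebra.
From mathcomp Require Import complex.
From mathcomp Require Import all_classical all_reals all_analysis.

Set Implicit Arguments.
Unset Strict Implicit.
Unset Printing Implicit Defensive.
Import Order.TTheory GRing.Theory Num.Theory.
Import numFieldNormedType.Exports.
Local Open Scope classical_set_scope.
Local Open Scope ring_scope.

Section Lattice.
Variable R : realType.
Implicit Types (u v : 'rV[R]_2) (n m : int * int).

Definition dotp u v : R := \sum_(i < 2) u 0 i * v 0 i.

(* The Euclidean norm; [`|u|] on row vectors is the sup norm. *)
Definition enorm u : R := Num.sqrt (dotp u u).

Definition dual_vec (k1 k2 : 'rV[R]_2) n : 'rV[R]_2 := k1 *~ n.1 + k2 *~ n.2.

Definition critical_indices (k1 k2 : 'rV[R]_2) : set (int * int) :=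
  [set n | n != (0, 0) /\
    forall m, m != (0, 0) ->
      enorm (dual_vec k1 k2 n) <= enorm (dual_vec k1 k2 m)].

Definition coef_beta (kc1 : 'rV[R]_2) (lambda : R) : R :=
  - enorm kc1 ^+ 2 * (enorm kc1 ^+ 2 - lambda).

Definition coef_xi (kc1 : 'rV[R]_2) (gamma2 gamma3 : R) : R :=
  (2 * gamma2 ^+ 2 - 9 * enorm kc1 ^+ 2 * gamma3) / 3.

Definition coef_eta (kc1 kc2 : 'rV[R]_2) (gamma2 gamma3 : R) : R :=
  2 * enorm kc1 ^+ 2 *
  (2 * gamma2 ^+ 2 / (enorm (kc1 - kc2) ^+ 2 - enorm kc1 ^+ 2)
   + 2 * gamma2 ^+ 2 / (enorm (kc1 + kc2) ^+ 2 - enorm kc1 ^+ 2)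
   - 3 * gamma3).

Definition threshold (kc1 kc2 : 'rV[R]_2) : R :=
  2 / 9 *
  Num.max (1 / (3 * enorm kc1 ^+ 2)
           + 2 / (enorm (kc1 - kc2) ^+ 2 - enorm kc1 ^+ 2)
           + 2 / (enorm (kc1 + kc2) ^+ 2 - enorm kc1 ^+ 2))
          (1 / enorm kc1 ^+ 2).

End Lattice.

(* Coordinates (y1, y3).  The topology of [R[i]] is carried by [R[i]^o]. *)
Notation phase R := (R[i]^o * R[i]^o)%type.

Section ReducedSystem.
Variable R : realType.
Local Open Scope complex_scope.

(* The modulus as an element of [R]; [`|z|] lives in [R[i]]. *)
Definition cmod (z : R[i]) : R := complex.Re `|z|.

Definition phase_norm (y : phase R) : R :=
  Num.sqrt (cmod y.1 ^+ 2 + cmod y.2 ^+ 2).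

Definition is_cderive (f : R -> R[i]) (t : R) (d : R[i]) : Prop :=
  is_derive t 1 (fun s => complex.Re (f s) : R^o) (complex.Re d) /\
  is_derive t 1 (fun s => complex.Im (f s) : R^o) (complex.Im d).

Definition cis (theta : R) : R[i] := cos theta +i* sin theta.

Definition collapse (y : phase R) : R * R := (cmod y.1, cmod y.2).

Variables beta xi eta : R.

Definition reduced_field (y : phase R) : phase R :=
  (beta%:C * y.1 + y.1 * (xi * cmod y.1 ^+ 2 + eta * cmod y.2 ^+ 2)%:C,
   beta%:C * y.2 + y.2 * (eta * cmod y.1 ^+ 2 + xi * cmod y.2 ^+ 2)%:C).

Definition collapsed_field (r : R * R) : R * R :=
  (beta * r.1 + r.1 * (xi * r.1 ^+ 2 + eta * r.2 ^+ 2),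
   beta * r.2 + r.2 * (eta * r.1 ^+ 2 + xi * r.2 ^+ 2)).

(* A solution on [0, +oo); its values at negative times are irrelevant. *)
Definition reduced_solution (u : R -> phase R) : Prop :=
  {within `[0, +oo[, continuous u} /\
  forall t, 0 < t ->
    is_cderive (fun s => (u s).1) t (reduced_field (u t)).1 /\
    is_cderive (fun s => (u s).2) t (reduced_field (u t)).2.

(* The semigroup S(t) of the reduced system.  The default value 0 is used only at a point from which
   no solution on [0, +oo) starts. *)
Definition flow (t : R) (y : phase R) : phase R :=
  xget (cst 0) [set u | reduced_solution u /\ u 0 = y] t.

Definition attracts (Sigma K : set (phase R)) : Prop :=
  forall d : R, 0 < d -> exists T : R, 0 <= T /\
    forall t y, T <= t -> K y ->
      exists z, Sigma z /\ phase_norm (flow t y - z) < d.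

(* The local attractor bifurcating from the origin.  It attracts a punctured
   neighbourhood of 0: on the center manifold, for lambda > lambda0, the stable
   manifold of 0 is reduced to 0.  Attraction uniform on compact sets is what
   makes Sigma contain the transients between the steady states. *)
Definition bifurcated_attractor (Sigma : set (phase R)) : Prop :=
  [/\ compact Sigma,
      ~ Sigma 0,
      (forall t, 0 <= t -> flow t @` Sigma = Sigma) &
      exists U : set (phase R),
        [/\ open U, U 0, Sigma `<=` U &
            forall K, compact K -> K `<=` U `\ 0 -> attracts Sigma K]].

End ReducedSystem.

Definition homeomorphic (X Y : topologicalType) (A : set X) (B : set Y) : Prop :=
  exists (f : X -> Y) (g : Y -> X),
    [/\ {within A, continuous f} /\ {within B, continuous g},
        f @` A `<=` B /\ g @` B `<=` A,
        (forall x, A x -> g (f x) = x) &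
        (forall y, B y -> f (g y) = y)].

Section SingularHomology.
Variable R : realType.

Definition std_simplex (n : nat) : set 'rV[R]_n.+1 :=
  [set x | (forall i, 0 <= x 0 i) /\ \sum_i x 0 i = 1].
Arguments std_simplex n : clear implicits.

Definition insert0 (n : nat) (i : 'I_n.+2) (x : 'rV[R]_n.+1) : 'rV[R]_n.+2 :=
  \row_j (if unlift i j is Some k then x 0 k else 0).

Lemma insert0_simplex (n : nat) (i : 'I_n.+2) (x : std_simplex n) :
  insert0 i (set_val x) \in (std_simplex n.+1 : set _).
Proof.
have [x_ge0 x_sum] := set_valP x.
apply/mem_set; split=> [j|].
  by rewrite mxE; case: (unlift i j).
rewrite (bigD1_ord i) //= !mxE unlift_none add0r -x_sum.
by apply: eq_bigr => k _; rewrite mxE liftK.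
Qed.

Definition face (n : nat) (i : 'I_n.+2) (x : std_simplex n) :
  std_simplex n.+1 := SigSub (insert0_simplex i x).

Variable X : topologicalType.

Definition chain (n : nat) : Type := (std_simplex n -> X) -> int.

(* Finitely supported integer combinations of continuous singular simplices
   with values in A. *)
Definition singular_chain (A : set X) (n : nat) : set (chain n) :=
  [set c | finite_set [set s | c s != 0] /\
           forall s, c s != 0 -> continuous s /\ range s `<=` A].

Definition chain_add (n : nat) (c d : chain n) : chain n :=
  fun s => c s + d s.

(* The coefficient of tau in the sum of the c(s) (-1)^i (s o face_i). *)
Definition boundary (n : nat) (c : chain n.+1) : chain n := fun tau =>
  \sum_(i < n.+2)
    (-1) ^+ i *
    \sum_(s \in [set s : std_simplex n.+1 -> X | s \o face i = tau]) c s.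

Definition cycle_of (A : set X) (n : nat) : set (chain n) :=
  match n with
  | 0 => singular_chain A (n := 0)
  | m.+1 => [set c | singular_chain A c /\ boundary c = fun=> 0]
  end.

Definition homologous (A : set X) (n : nat) (c d : chain n) : Prop :=
  exists b : chain n.+1,
    singular_chain A b /\ c = chain_add d (boundary b).

End SingularHomology.

(* An isomorphism from H_n(A) to H_n(B), given by its action on representing
   cycles. *)
Definition homology_iso (R : realType) (X Y : topologicalType)
    (A : set X) (B : set Y) (n : nat) : Prop :=
  exists f : chain R X n -> chain R Y n,
    [/\ forall c, cycle_of A c -> cycle_of B (f c),
        forall c d, cycle_of A c -> cycle_of A d ->
          homologous B (f (chain_add c d)) (chain_add (f c) (f d)),
        forall c d, cycle_of A c -> cycle_of A d ->
          (homologous A c d <-> homologous B (f c) (f d)) &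
        forall e, cycle_of B e -> exists c, cycle_of A c /\ homologous B (f c) e].

Definition homological_to (R : realType) (X Y : topologicalType)
    (A : set X) (B : set Y) : Prop :=
  forall n, homology_iso R A B n.

Section Models.
Variable R : realType.
Local Open Scope complex_scope.

Definition sphere3 : set (phase R) := [set y | phase_norm y = 1].

Definition circle : set R[i]^o := [set z | cmod z = 1].

Definition is_arc (A : set (R * R)) : Prop :=
  homeomorphic (`[0, 1]%classic : set R) A.

Definition is_circle (A : set (phase R)) : Prop := homeomorphic circle A.

Definition is_torus (A : set (phase R)) : Prop :=
  homeomorphic (circle `*` circle) A.

Definition generated_set (p : R * R) : set (phase R) :=
  [set y | exists theta1 theta2 : R,
     y = (p.1%:C * cis theta1, p.2%:C * cis theta2)].

End Models.

(* Main.v *)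
(** Write xi = - a and eta = a - 2 h; the hypotheses on the lattice and on gamma3
    give a, h > 0.  With A = 4 r1^2 r2^2 and B = (r1^2 - r2^2)^2, put
      G = beta * int_{-oo}^0 (A e^{-2 h u} + B e^{-2 a u})^{-1/2} du.
    In the time tau with d tau = 2 (r1^2 + r2^2) dt, A and B are exponentials up
    to a common factor, so the flow translates the integrand and G satisfies the
    linear equation G' = 2 beta (1 - G).  Since G is positive and homogeneous of
    degree -2, the invariant set {G = 1} is a radial graph over S^3 and attracts
    every compact set avoiding 0.  It is the only attractor because orbits of
    points just inside it can be followed back to level sets {G = L} near 0.
    On the axes and on the diagonal G is explicit, which places the three steady
    states on {G = 1}. *)
Require Import Defs.
From mathcomp Require Import all_boot all_order all_algebra.
From mathcomp Require Import complex ring lra zify.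
From mathcomp Require Import all_classical all_reals all_analysis.
From mathcomp Require Import measurable_realfun.
Set Implicit Arguments.
Unset Strict Implicit.
Unset Printing Implicit Defensive.
Import Order.TTheory GRing.Theory Num.Theory.
Import numFieldNormedType.Exports.
Local Open Scope classical_set_scope.
Local Open Scope ring_scope.

(** * Homology of homeomorphic sets *)

(** With x = r1^2 and w = r2^2 one has (x w)' = x w (4 beta - 4 h (x + w)), (x - w)' = (x - w) (2
    beta - 2 a (x + w)) and 4 x w + (x - w)^2 = (x + w)^2, so a single change of time makes both
    quantities exponential. What remains is one scalar relation: s = exp(2 beta t) satisfies ds/dtau
    = beta / sqrt (A e^{-2 h tau} + B e^{-2 a tau}). Integrating from -oo gives s = 1 - G + beta *
    (the integral up to tau), and G is read off from the backward orbit. If G > 1, then s tends to 0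
    at a finite tau and the orbit comes out of the origin; if G < 1, then tau runs down to -oo while
    s stays positive, a blow-up at a finite negative time; G = 1 is the borderline. The signs a, h >
    0 make the integral converge at -oo. Since the semigroup is defined by choosing a solution, the
    relation has to be inverted into genuine solutions of the complex system, and uniqueness has to
    be proved for all solutions on [0, +oo). *)

Lemma within_continuous_comp (T X Y : topologicalType) (A : set X)
    (f : X -> Y) (s : T -> X) :
  {within A, continuous f} -> continuous s -> range s `<=` A ->
  continuous (f \o s).
Proof.
move=> /subspace_continuousP cf cs sA t.
have As : A (s t) by apply: sA; exists t.
apply: (cvg_trans _ (cf _ As)) => U UA.
rewrite nbhs_filterE /fmap /=.
apply: (@filterS _ (nbhs t) _ _ _ _ (cs t _ UA)) => v; apply.
by apply: sA; exists v.
Qed.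

Section Pushforward.
Variables (R : realType) (X Y : topologicalType) (A : set X) (B : set Y).
Variables (f : X -> Y) (g : Y -> X).

(** The coefficient of [s] is read off at [g \o s], the unique simplex in [A] that [f] sends to [s],
    so no sum over a fibre of [f] is needed. The guard is essential: outside [B] the values of [g]
    are arbitrary and might fall into [A]. *)
Definition push_chain (n : nat) (c : chain R X n) : chain R Y n :=
  fun s => if `[< range s `<=` B >] then c (g \o s) else 0.

Hypotheses (cf : {within A, continuous f}) (cg : {within B, continuous g}).
Hypotheses (fAB : f @` A `<=` B) (gBA : g @` B `<=` A).
Hypotheses (fK : forall x, A x -> g (f x) = x) (gK : forall y, B y -> f (g y) = y).

Let push_neq0 n (c : chain R X n) s :
  push_chain c s != 0 -> range s `<=` B /\ c (g \o s) != 0.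
Proof. by rewrite /push_chain; case: asboolP => // _; rewrite eqxx. Qed.

Let fgK (T : Type) (s : T -> Y) : range s `<=` B -> f \o (g \o s) = s.
Proof. by move=> sB; apply/funext => t /=; apply/gK/sB; exists t. Qed.

Let gfK (T : Type) (s : T -> X) : range s `<=` A -> g \o (f \o s) = s.
Proof. by move=> sB; apply/funext => t /=; apply/fK/sB; exists t. Qed.

Let range_f (T : Type) (s : T -> X) : range s `<=` A -> range (f \o s) `<=` B.
Proof. by move=> sA _ [t _ <-]; apply: fAB; exists (s t) => //; apply: sA; exists t. Qed.

Let range_g (T : Type) (s : T -> Y) : range s `<=` B -> range (g \o s) `<=` A.
Proof. by move=> sA _ [t _ <-]; apply: gBA; exists (s t) => //; apply: sA; exists t. Qed.

Lemma push_singular n (c : chain R X n) :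
  singular_chain A c -> singular_chain B (push_chain c).
Proof.
move=> [fc hc]; split.
  pose F (s : @std_simplex R n -> X) : @std_simplex R n -> Y := f \o s.
  have fF : finite_set (F @` [set s | c s != 0]) by exact: finite_image fc.
  apply: sub_finite_set fF => s /push_neq0[sB c0].
  by exists (g \o s) => //; exact: fgK.
move=> s /push_neq0[sB /hc[cgs rgs]]; split => //.
by rewrite -(fgK sB); exact: within_continuous_comp cf cgs rgs.
Qed.

(** Composition with [g] matches the simplices in [B] having a given face with the simplices in [A]
    having the corresponding face. When [t] leaves [B], so does every simplex of which it is a face,
    and both sides vanish. *)
Lemma boundary_push n (c : chain R X n.+1) : singular_chain A c ->
  boundary (push_chain c) = push_chain (boundary c).
Proof.
move=> [_ hc]; apply/funext => t; rewrite /boundary [RHS]/push_chain.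
case: asboolP => [tB|ntB]; last first.
  rewrite big1// => i _; rewrite fsbig1 ?mulr0// => s /= st.
  rewrite /push_chain; case: asboolP => // sB; case: ntB.
  by rewrite -st => _ [u _ <-] /=; apply: sB; exists (face i u).
rewrite /=; apply: eq_bigr => i _; congr (_ * _).
pose P := [set s : @std_simplex R n.+1 -> Y | s \o face i = t /\ range s `<=` B].
pose Q := [set s : @std_simplex R n.+1 -> X | s \o face i = g \o t /\ range s `<=` A].
(* Both sums are cut down to the simplices that stay in [B], respectively in [A]: the others have
   coefficient 0, and only between these two sets is composition with [g] a bijection. *)
rewrite -(@fsbig_widen _ _ _ _ P); last 2 first.
- by move=> s [].
- by move=> s [/= st nP]; rewrite /push_chain; case: asboolP => // sB; case: nP.
rewrite -(@fsbig_widen _ _ _ _ Q); last 2 first.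
- by move=> s [].
- move=> s [/= st nQ]; apply/eqP/negPn/negP => /hc[_ sA]; exact: nQ.
rewrite (reindex_fsbig (fun s : @std_simplex R n.+1 -> Y => g \o s) P Q).
  apply: eq_fsbigr => s; rewrite inE => -[_ sB].
  by rewrite /push_chain; case: asboolP.
split=> [s [st sB]|s s'|s [st sA]].
- by split; [rewrite -st|exact: range_g].
- by rewrite !inE => -[_ sB] [_ s'B] E; rewrite -(fgK sB) -(fgK s'B) E.
- exists (f \o s); last exact: gfK.
  split; last exact: range_f.
  by rewrite -[LHS]/(f \o (s \o face i)) st fgK.
Qed.

Lemma push_cycle n (c : chain R X n) : cycle_of A c -> cycle_of B (push_chain c).
Proof.
case: n c => [|n] c /=; first exact: push_singular.
move=> [sc bc]; split; first exact: push_singular.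
rewrite boundary_push// bc; apply/funext => s.
by rewrite /push_chain; case: asboolP.
Qed.

Lemma push_chain_add n (c d : chain R X n) :
  push_chain (chain_add c d) = chain_add (push_chain c) (push_chain d).
Proof.
apply/funext => s; rewrite /push_chain /chain_add.
by case: asboolP => // _; rewrite addr0.
Qed.

Lemma push_homologous n (c d : chain R X n) :
  homologous A c d -> homologous B (push_chain c) (push_chain d).
Proof.
move=> [b [sb ->]]; exists (push_chain b); split; first exact: push_singular.
by rewrite push_chain_add boundary_push.
Qed.

End Pushforward.

Lemma cycle_singular (R : realType) (X : topologicalType) (A : set X) n
  (c : chain R X n) : cycle_of A c -> singular_chain A c.
Proof. by case: n c => [//|n] c []. Qed.

(** The guards lose nothing, because a singular chain of [A] has coefficient 0 on every simplex that
    leaves [A]. *)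
Lemma push_chainK (R : realType) (X Y : topologicalType) (A : set X) (B : set Y)
    (f : X -> Y) (g : Y -> X) n (c : chain R X n) :
  f @` A `<=` B -> g @` B `<=` A -> (forall x, A x -> g (f x) = x) ->
  singular_chain A c -> push_chain A f (push_chain B g c) = c.
Proof.
move=> fAB gBA fK [_ hc]; apply/funext => s; rewrite /push_chain.
have cA : ~ range s `<=` A -> c s = 0.
  by move=> nA; apply/eqP/negPn/negP => /hc[_].
case: asboolP => [sA|/cA//]; case: asboolP => [_|[]].
  by congr c; apply/funext => t /=; apply/fK/sA; exists t.
move=> _ [t _ <-]; apply: fAB; exists (s t) => //; apply: sA; by exists t.
Qed.

Lemma homologous_refl (R : realType) (X : topologicalType) (A : set X) n
  (c : chain R X n) : homologous A c c.
Proof.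
exists (fun=> 0); split.
  split; last by move=> s; rewrite eqxx.
  by rewrite (_ : [set s | _] = set0) //; apply/seteqP; split => // s; rewrite /= eqxx.
apply/funext => s; rewrite /chain_add /boundary big1 ?addr0// => i _.
by rewrite fsbig1 ?mulr0.
Qed.

Lemma homeomorphic_homological (R : realType) (X Y : topologicalType)
  (A : set X) (B : set Y) : homeomorphic A B -> homological_to R A B.
Proof.
move=> [f [g [[cf cg] [fAB gBA] fK gK]]] n.
exists (@push_chain R X Y B g n); split.
- by move=> c; exact: push_cycle.
- by move=> c d _ _; rewrite push_chain_add; exact: homologous_refl.
- move=> c d hc hd; split; first exact: push_homologous.
  move=> /(push_homologous cg gBA fAB gK fK).
  by rewrite !push_chainK //; exact: cycle_singular.
- move=> e he; exists (push_chain A f e); split; first exact: push_cycle.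
  by rewrite push_chainK //; [exact: homologous_refl|exact: cycle_singular].
Qed.

(** * Real calculus *)

Section RealCalculus.
Variable R : realType.
Implicit Types (f g : R -> R) (x df dg c : R).

Lemma is_derive_addr f g x df dg : is_derive x 1 f df -> is_derive x 1 g dg ->
  is_derive x 1 (fun y => f y + g y) (df + dg).
Proof. by move=> hf hg; have := is_deriveD hf hg. Qed.

Lemma is_derive_subr f g x df dg : is_derive x 1 f df -> is_derive x 1 g dg ->
  is_derive x 1 (fun y => f y - g y) (df - dg).
Proof. by move=> hf hg; have := is_deriveB hf hg. Qed.

Lemma is_derive_const c x : is_derive x 1 (fun=> c) 0.
Proof. exact: is_derive_cst. Qed.

Lemma is_derive_mulr f g x df dg : is_derive x 1 f df -> is_derive x 1 g dg ->
  is_derive x 1 (fun y => f y * g y) (df * g x + f x * dg).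
Proof.
move=> hf hg; have := is_deriveM hf hg.
by move=> /is_derive_eq; apply; rewrite addrC mulrC.
Qed.

Lemma is_derive_cstl c f x df : is_derive x 1 f df ->
  is_derive x 1 (fun y => c * f y) (c * df).
Proof. by move=> hf; have := is_deriveZ c hf. Qed.

Lemma is_derive_expR_comp f x df : is_derive x 1 f df ->
  is_derive x 1 (fun y => expR (f y)) (expR (f x) * df).
Proof. by move=> hf; have := is_derive1_comp (is_derive_expR (f x)) hf. Qed.

Lemma is_derive_sqrt_comp f x df : 0 < f x -> is_derive x 1 f df ->
  is_derive x 1 (fun y => Num.sqrt (f y)) (df / (2 * Num.sqrt (f x))).
Proof.
move=> f0 hf; have := is_derive1_comp (is_derive1_sqrt f0) hf.
by rewrite mulrC.
Qed.

Lemma is_derive_sqr f x df : is_derive x 1 f df ->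
  is_derive x 1 (fun y => f y ^+ 2) (2 * f x * df).
Proof.
move=> hf; have := is_derive_mulr hf hf.
by move=> /is_derive_eq; apply; rewrite mulrC -mulrDr -mulr2n -mulr_natl; ring.
Qed.

Lemma is_derive_scalel c x : is_derive x 1 (fun y : R => c * y) c.
Proof. by have := is_derive_cstl c (is_derive_id x 1); rewrite mulr1. Qed.

Lemma is_derive_continuous f x df : is_derive x 1 f df -> {for x, continuous f}.
Proof.
by case=> hf _; exact/differentiable_continuous/derivable1_diffP.
Qed.

End RealCalculus.

(** The mean value theorem applied to exp(- C s) w(s). Differentiability is asked on the open
    interval only, since a solution on [0, +oo) is merely continuous at time 0. *)
Lemma gronwall_le0 (R : realType) (w dw : R -> R) (T C : R) : 0 < T ->
  {within `[0, T], continuous w} ->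
  (forall t, 0 < t < T -> is_derive t 1 w (dw t)) ->
  (forall t, 0 < t < T -> dw t <= C * w t) -> w 0 = 0 -> w T <= 0.
Proof.
move=> T0 cw dwE dwC w0.
have dE (t : R) : is_derive t 1 (fun s : R => expR (- C * s)) (expR (- C * t) * - C).
  exact: is_derive_expR_comp (is_derive_scalel (- C) t).
pose g s := expR (- C * s) * w s.
have dg (t : R) : t \in `]0, T[ ->
    is_derive t 1 g (expR (- C * t) * - C * w t + expR (- C * t) * dw t).
  by rewrite in_itv /= => tT; exact: is_derive_mulr (dE t) (dwE t tT).
have cg : {within `[0, T], continuous g}.
  move=> t; apply: (@cvgM R _ _ _ (fun s => expR (- C * s)) w); last exact: cw.
  have cE : continuous (fun s : R => expR (- C * s)).
    by move=> s; exact: is_derive_continuous (dE s).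
  exact: (continuous_subspaceT cE).
have [c cT] := MVT T0 dg cg.
rewrite /g w0 mulr0 !subr0 => E.
have : expR (- C * T) * w T <= 0.
  rewrite E pmulr_lle0// -mulrA -mulrDr pmulr_rle0 ?expR_gt0//.
  by rewrite mulNr addrC subr_le0; apply: dwC; move: cT; rewrite in_itv.
by rewrite pmulr_rle0// expR_gt0.
Qed.

(** * The improper integral behind the conserved gauge *)

Section Mass.
Variable R : realType.
Implicit Types A B a h c u y t : R.
Notation mu := (@lebesgue_measure R).

Definition rad a h A B u : R :=
  A * expR (- (2 * h * u)) + B * expR (- (2 * a * u)).

Definition dens a h A B u : R := (Num.sqrt (rad a h A B u))^-1.

Definition mass a h A B : R := \int[mu]_(u in `]-oo, 0]) dens a h A B u.

Lemma integral_expR_Ny c y : 0 < c ->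
  (\int[mu]_(u in `]-oo, y]) (expR (c * u))%:E = (expR (c * y) / c)%:E)%E.
Proof.
(* Reflection moves the half-line to [- y, +oo[, where the primitive tends to 0 at +oo. *)
move=> c0; rewrite -[y in `]-oo, y]]opprK ge0_integration_by_substitutionNy; first last.
- by move=> x _; exact: expR_ge0.
- apply: continuous_subspaceT => x.
  exact: is_derive_continuous (is_derive_expR_comp (is_derive_scalel c x)).
have dG (x : R) : is_derive x 1 (fun x : R => expR (c * - x)) (expR (c * - x) * - c).
  apply: is_derive_expR_comp; have := is_derive_scalel (- c) x.
  by under eq_fun do rewrite mulNr -mulrN.
have dF (x : R) : is_derive x 1 (fun x => - c^-1 * expR (c * - x)) (expR (c * - x)).
  by move: (is_derive_cstl (- c^-1) (dG x)) => /is_derive_eq; apply; field; rewrite gt_eqF.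
rewrite (@ge0_continuous_FTC2y _ (fun x => expR (c * - x))
  (fun x => - c^-1 * expR (c * - x)) (- y) 0).
- by rewrite sub0e -EFinN opprK mulNr opprK mulrC.
- by move=> x _; exact: expR_ge0.
- by apply: continuous_subspaceT => x; exact: is_derive_continuous (dG x).
- rewrite -(mulr0 (- c^-1)); apply: cvgMl_tmp.
  under eq_fun do rewrite mulrN.
  have cy : c * x @[x --> +oo] --> +oo by apply: gt0_cvgMry => //; exact: cvg_id.
  exact: cvg_comp cy (@cvgr_expR R).
- by move=> x _; case: (dF x).
- by apply: cvg_at_right_filter; exact: is_derive_continuous (dF _).
- by move=> x _; rewrite derive1E; have [] := dF x.
Qed.

Lemma integrable_expR_Ny (k c y : R) : 0 < c ->
  mu.-integrable `]-oo, y] (EFin \o (fun u => k * expR (c * u))).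
Proof.
move=> c0; have : mu.-integrable `]-oo, y] (EFin \o (fun u => expR (c * u))).
  apply/integrableP; split.
    apply/measurable_EFinP; apply: measurable_funTS.
    apply: continuous_measurable_fun => x.
    exact: is_derive_continuous (is_derive_expR_comp (is_derive_scalel c x)).
  under eq_integral do rewrite /= ger0_norm ?expR_ge0//.
  by rewrite integral_expR_Ny// ltry.
move=> H; have : mu.-integrable `]-oo, y] (fun u => k%:E * (EFin \o (fun u => expR (c * u))) u)%E.
  exact: integrableZl.
by apply: eq_integrable.
Qed.

Lemma Rintegral_expR_Ny (k c : R) : 0 < c ->
  \int[mu]_(u in `]-oo, 0]) (k * expR (c * u)) = k / c.
Proof.
move=> c0; rewrite RintegralZl//.
  by rewrite /Rintegral integral_expR_Ny//= mulr0 expR0 div1r.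
have := integrable_expR_Ny 1 0 c0; apply: eq_integrable => //= u _.
by rewrite mul1r.
Qed.

(** * Bounds, translation and homogeneity of the mass *)

Section Density.
Variables a h : R.
Hypotheses (a0 : 0 < a) (h0 : 0 < h).
Local Notation m := (Num.min a h).
Local Notation M := (Num.max a h).
Local Notation rad := (rad a h).
Local Notation dens := (dens a h).
Local Notation mass := (mass a h).

Lemma rad_shift A B u t :
  rad A B (u + t) = rad (A * expR (- (2 * h * t))) (B * expR (- (2 * a * t))) u.
Proof.
by rewrite /rad -!mulrA -!expRD; congr (_ * expR _ + _ * expR _); ring.
Qed.

Lemma rad0 A B : rad A B 0 = A + B.
Proof. by rewrite /rad !mulr0 oppr0 expR0 !mulr1. Qed.

Lemma rad_gt0 A B u : 0 <= A -> 0 <= B -> 0 < A + B -> 0 < rad A B u.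
Proof.
move=> A0 B0; rewrite /rad; have [-> B1|A1 _] := eqVneq A 0.
  by rewrite mul0r add0r mulr_gt0 ?expR_gt0//; lra.
rewrite ltr_pwDl ?mulr_ge0 ?expR_ge0// mulr_gt0 ?expR_gt0//.
by rewrite lt_neqAle eq_sym A1.
Qed.

Lemma is_derive_rad A B u :
  is_derive u 1 (rad A B) (A * (expR (- (2 * h * u)) * - (2 * h)) +
                           B * (expR (- (2 * a * u)) * - (2 * a))).
Proof.
have E k : is_derive u 1 (fun u => expR (- (k * u))) (expR (- (k * u)) * - k).
  apply: is_derive_expR_comp; have := is_derive_scalel (- k) u.
  by under eq_fun do rewrite mulNr.
by apply: is_derive_addr; apply: is_derive_cstl; exact: E.
Qed.

Lemma dens_gt0 A B u : 0 <= A -> 0 <= B -> 0 < A + B -> 0 < dens A B u.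
Proof. by move=> A0 B0 AB; rewrite invr_gt0 sqrtr_gt0 rad_gt0. Qed.

Lemma continuous_dens A B : 0 <= A -> 0 <= B -> 0 < A + B -> continuous (dens A B).
Proof.
move=> A0 B0 AB u; apply: cvgV.
  by rewrite gt_eqF// sqrtr_gt0 rad_gt0.
apply: is_derive_continuous (is_derive_sqrt_comp _ (is_derive_rad A B u)).
exact: rad_gt0.
Qed.

Lemma expR_sqrt (x : R) : Num.sqrt (expR (- (2 * x))) = expR (- x).
Proof.
have -> : - (2 * x) = - x + - x by ring.
by rewrite expRD -expr2 sqrtr_sqr ger0_norm// expR_ge0.
Qed.

(** For u <= 0 both exponentials in [rad] are at least exp(- 2 m u). The resulting bound sees A and
    B only through A + B, which makes it a dominating function that is uniform in their ratio. *)
Lemma dens_le A B u : 0 <= A -> 0 <= B -> 0 < A + B -> u <= 0 ->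
  dens A B u <= (Num.sqrt (A + B))^-1 * expR (m * u).
Proof.
move=> A0 B0 AB u0; rewrite -[expR _]invrK -expRN -invfM lef_pV2 ?posrE; last 2 first.
- by rewrite sqrtr_gt0 rad_gt0.
- by rewrite mulr_gt0 ?expR_gt0 ?sqrtr_gt0.
rewrite -expR_sqrt -sqrtrM; last lra.
apply: ler_wsqrtr; rewrite /rad mulrDl.
by apply: lerD; apply: ler_wpM2l => //; rewrite ler_expR lerN2 mulrA;
  apply: ler_wnM2r => //; rewrite ler_pM2l// ge_min lexx ?orbT.
Qed.

Lemma dens_ge A B u : 0 <= A -> 0 <= B -> 0 < A + B -> u <= 0 ->
  (Num.sqrt (A + B))^-1 * expR (M * u) <= dens A B u.
Proof.
move=> A0 B0 AB u0; rewrite -[expR _]invrK -expRN -invfM lef_pV2 ?posrE; last 2 first.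
- by rewrite mulr_gt0 ?expR_gt0 ?sqrtr_gt0.
- by rewrite sqrtr_gt0 rad_gt0.
rewrite -expR_sqrt -sqrtrM; last lra.
apply: ler_wsqrtr; rewrite /rad [leRHS]mulrDl.
by apply: lerD; apply: ler_wpM2l => //; rewrite ler_expR lerN2 mulrA;
  apply: ler_wnM2r => //; rewrite ler_pM2l// le_max lexx ?orbT.
Qed.

Lemma m_gt0 : 0 < m. Proof. by rewrite lt_min a0 h0. Qed.
Lemma M_gt0 : 0 < M. Proof. by rewrite lt_max a0. Qed.

Lemma dens_shift A B u t :
  dens A B (u + t) = dens (A * expR (- (2 * h * t))) (B * expR (- (2 * a * t))) u.
Proof. by rewrite /dens rad_shift. Qed.

Lemma shift_ge0 A k : 0 <= A -> 0 <= A * expR k.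
Proof. by move=> A0; rewrite mulr_ge0 ?expR_ge0. Qed.

Lemma shift_gt0 A B t : 0 <= A -> 0 <= B -> 0 < A + B ->
  0 < A * expR (- (2 * h * t)) + B * expR (- (2 * a * t)).
Proof. exact: rad_gt0. Qed.

Lemma integrable_dens A B y : 0 <= A -> 0 <= B -> 0 < A + B ->
  mu.-integrable `]-oo, y] (EFin \o dens A B).
Proof.
move=> A0 B0 AB.
(* [dens_le] holds on the negative half-line only, so it is used after translating the endpoint y to
   0; C is the value of the density at y. *)
pose C := (Num.sqrt (A * expR (- (2 * h * y)) + B * expR (- (2 * a * y))))^-1.
apply: (@le_integrable _ _ _ mu _ _ _
  (EFin \o (fun u => C * expR (- (m * y)) * expR (m * u)))) => //.
- apply/measurable_EFinP; apply: measurable_funTS.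
  by apply: continuous_measurable_fun; exact: continuous_dens.
- move=> u /=; rewrite in_itv /= => uy; rewrite lee_fin.
  rewrite !ger0_norm ?(ltW (dens_gt0 _ _ _ _))// ?mulr_ge0 ?expR_ge0 ?invr_ge0//.
  rewrite -mulrA -expRD (_ : - _ + _ = m * (u - y)); last ring.
  rewrite -[in X in X <= _](subrK y u) dens_shift; apply: dens_le.
  + exact: shift_ge0.
  + exact: shift_ge0.
  + exact: shift_gt0.
  + by rewrite subr_le0.
- exact: integrable_expR_Ny m_gt0.
Qed.

(* The substitution [u + t]: moving (A, B) along the flow translates the
   integrand, hence only changes the endpoint of the integral. *)
Lemma mass_shift A B t : 0 <= A -> 0 <= B -> 0 < A + B ->
  mass (A * expR (- (2 * h * t))) (B * expR (- (2 * a * t))) =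
  \int[mu]_(u in `]-oo, t]) dens A B u.
Proof.
move=> A0 B0 AB; rewrite /mass /Rintegral; congr fine.
have dF (u : R) : is_derive u 1 (fun u : R => u + t) 1.
  by have := is_derive_addr (is_derive_id u 1) (is_derive_cst t u 1); rewrite addr0.
have F' : derive1 (fun u : R => u + t) = cst 1.
  by apply/funext => u; rewrite derive1E; have [] := dF u.
rewrite -[t in RHS]add0r.
rewrite (@increasing_ge0_integration_by_substitutionNy _ (fun u => u + t) (dens A B) 0).
- apply: eq_integral => u _ /=; rewrite F' /= fctE /= dens_shift.
  by rewrite mulr1.
- by move=> u v _ _; rewrite ltrD2r.
- by rewrite F' => ? _; exact: cst_continuous.
- by rewrite F'; exact: is_cvg_cst.
- by rewrite F'; exact: cvg_cst.
- split; first by move=> u _; have [] := dF u.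
  by apply: cvg_at_left_filter; exact: is_derive_continuous (dF 0).
- exact: cvg_addrr_Ny.
- by apply: continuous_subspaceT; exact: continuous_dens.
- by move=> u _; apply/ltW/dens_gt0.
Qed.

Lemma is_derive_mass_shift A B t : 0 <= A -> 0 <= B -> 0 < A + B ->
  is_derive t 1
    (fun t : R => mass (A * expR (- (2 * h * t))) (B * expR (- (2 * a * t))))
    (dens A B t).
Proof.
move=> A0 B0 AB; under eq_fun do rewrite mass_shift//.
have [] := @continuous_FTC1 R (dens A B) -oo%O t (t + 1) _ _ _ _.
- by rewrite ltrDl.
- exact: integrable_dens.
- by rewrite ltNyr.
- exact: continuous_dens.
by rewrite derive1E => dD <-; exact: DeriveDef.
Qed.

Lemma mass_le A B : 0 <= A -> 0 <= B -> 0 < A + B ->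
  mass A B <= (Num.sqrt (A + B))^-1 / m.
Proof.
move=> A0 B0 AB; rewrite -(Rintegral_expR_Ny _ m_gt0).
apply: le_Rintegral => //; first exact: integrable_dens.
  exact: integrable_expR_Ny m_gt0.
by move=> u /=; rewrite in_itv /=; exact: dens_le.
Qed.

Lemma mass_ge A B : 0 <= A -> 0 <= B -> 0 < A + B ->
  (Num.sqrt (A + B))^-1 / M <= mass A B.
Proof.
move=> A0 B0 AB; rewrite -(Rintegral_expR_Ny _ M_gt0).
apply: le_Rintegral => //; first exact: integrable_expR_Ny M_gt0.
  exact: integrable_dens.
by move=> u /=; rewrite in_itv /=; exact: dens_ge.
Qed.

Lemma mass_gt0 A B : 0 <= A -> 0 <= B -> 0 < A + B -> 0 < mass A B.
Proof.
move=> A0 B0 AB; apply: lt_le_trans (mass_ge A0 B0 AB).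
by rewrite divr_gt0 ?M_gt0// invr_gt0 sqrtr_gt0.
Qed.

Lemma mass_scale c A B : 0 < c -> 0 <= A -> 0 <= B -> 0 < A + B ->
  mass (c ^+ 2 * A) (c ^+ 2 * B) = c^-1 * mass A B.
Proof.
move=> c0 A0 B0 AB; rewrite -RintegralZl//; last exact: integrable_dens.
apply: eq_Rintegral => u _; rewrite /dens -invfM; congr (_^-1).
have -> : rad (c ^+ 2 * A) (c ^+ 2 * B) u = c ^+ 2 * rad A B u.
  by rewrite /rad; ring.
by rewrite sqrtrM ?sqr_ge0// sqrtr_sqr gtr0_norm.
Qed.

Lemma mass_A0 A : 0 < A -> mass A 0 = (Num.sqrt A)^-1 / h.
Proof.
move=> A0; rewrite -Rintegral_expR_Ny//; apply: eq_Rintegral => u _.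
rewrite /dens /rad mul0r addr0 sqrtrM; last exact: ltW.
by rewrite -mulrA expR_sqrt invfM -expRN opprK.
Qed.

Lemma mass_0B B : 0 < B -> mass 0 B = (Num.sqrt B)^-1 / a.
Proof.
move=> A0; rewrite -Rintegral_expR_Ny//; apply: eq_Rintegral => u _.
rewrite /dens /rad mul0r add0r sqrtrM; last exact: ltW.
by rewrite -mulrA expR_sqrt invfM -expRN opprK.
Qed.

(* Extends [Z |-> mass (1 - Z) Z] from [0, 1] to an open set, as
   [continuity_under_integral] requires. *)
Definition clamp (Z : R) : R := Num.max 0 (Num.min 1 Z).

Lemma clamp_itv Z : 0 <= clamp Z <= 1.
Proof. by rewrite /clamp le_max lexx /= ge_max ler01 /= ge_min lexx. Qed.

Lemma clamp_id Z : 0 <= Z <= 1 -> clamp Z = Z.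
Proof. by move=> /andP[Z0 Z1]; rewrite /clamp (min_idPr Z1) (max_idPr Z0). Qed.

Lemma continuous_clamp : continuous clamp.
Proof.
move=> Z; apply: continuous_max; first exact: cst_continuous.
by apply: continuous_min; [exact: cst_continuous|exact: cvg_id].
Qed.

(** Here A + B = 1, so [dens_le] dominates all the densities by the single function exp(m u), and
    the integral depends continuously on Z. *)
Lemma continuous_mass_clamp : continuous (fun Z => mass (1 - clamp Z) (clamp Z)).
Proof.
move=> Z; have ZI : `](Z - 1), (Z + 1)[%classic Z.
  by rewrite /= in_itv /=; lra.
have P W : [/\ 0 <= 1 - clamp W, 0 <= clamp W & 0 < 1 - clamp W + clamp W].
  by have := clamp_itv W => /andP[? ?]; split; lra.
apply: (@continuity_under_integral R _ _ mu
  (fun Z => dens (1 - clamp Z) (clamp Z)) `]-oo, 0] _ (Z - 1) (Z + 1) _ _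
  (fun u => 1 * expR (m * u))) => //.
- by move=> W _; have [? ? ?] := P W; exact: integrable_dens.
- apply: aeW => u _ W _; have [? ? ?] := P W; apply: cvgV.
    by rewrite gt_eqF// sqrtr_gt0 rad_gt0.
  apply: continuous_comp; last exact: sqrt_continuous.
  apply: cvgD; apply: cvgMr_tmp; last exact: continuous_clamp.
  by apply: cvgB; [exact: cvg_cst|exact: continuous_clamp].
- exact: integrable_expR_Ny m_gt0.
- move=> W _; apply: aeW => u; rewrite /= in_itv /= => u0.
  have [? ? ?] := P W; rewrite ger0_norm ?(ltW (dens_gt0 _ _ _ _))//.
  by have := @dens_le (1 - clamp W) (clamp W) u; rewrite subrK sqrtr1 invr1; exact.
- exact: mem_set.
Qed.

End Density.
End Mass.

(** * The explicit radial solution *)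

Section RadialSolution.
Variables (R : realType) (a h beta x0 w0 : R).
Hypotheses (a0 : 0 < a) (h0 : 0 < h) (b0 : 0 < beta).
Hypotheses (x0_ge0 : 0 <= x0) (w0_ge0 : 0 <= w0) (s0_gt0 : 0 < x0 + w0).
Implicit Types t u v : R.
Let A := 4 * x0 * w0.
Let B := (x0 - w0) ^+ 2.
Local Notation m := (Num.min a h).
Local Notation M := (Num.max a h).

Let A_ge0 : 0 <= A. Proof. by rewrite /A !mulr_ge0. Qed.
Let B_ge0 : 0 <= B. Proof. exact: sqr_ge0. Qed.
Let AB : A + B = (x0 + w0) ^+ 2. Proof. by rewrite /A /B; ring. Qed.
Let AB_gt0 : 0 < A + B. Proof. by rewrite AB exprn_gt0. Qed.

(* With x = r1^2, w = r2^2 and the time tau given by d tau = 2 (x + w) dt,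
   4 x w and (x - w)^2 are, up to the factor exp(4 beta t), the exponentials
   exp(-2 h tau) and exp(-2 a tau).  The relation between tau and t integrates
   to clock tau = clock 0 + (exp(2 beta t) - 1) / beta. *)
Definition clock (t : R) : R :=
  mass a h (4 * x0 * w0 * expR (- (2 * h * t))) ((x0 - w0) ^+ 2 * expR (- (2 * a * t))).

Let is_derive_clock (t : R) : is_derive t 1 clock (dens a h A B t).
Proof. exact: is_derive_mass_shift. Qed.

Let clock_cont : continuous clock.
Proof. by move=> t; exact: is_derive_continuous (is_derive_clock t). Qed.

Let clock_incr t u : t < u -> clock t < clock u.
Proof.
move=> tu; have [|v vI E] := MVT tu (fun v _ => is_derive_clock v).
  exact: continuous_subspaceT.
by rewrite -subr_gt0 E mulr_gt0 ?subr_gt0// dens_gt0.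
Qed.

Let clock_inj : injective clock.
Proof.
by move=> t u E; have [/clock_incr|/clock_incr|] := ltgtP t u; rewrite ?E ?ltxx.
Qed.

Lemma clock0 : clock 0 = mass a h A B.
Proof. by rewrite /clock !mulr0 oppr0 expR0 !mulr1. Qed.

(** The mass at the translated pair lies between dens(t) / M and dens(t) / m, and the density grows
    exponentially from 0 to infinity; the intermediate value theorem then applies between two
    explicit times. *)
Let clock_surj v : 0 < v -> exists t, clock t = v.
Proof.
move=> v0; have m0 := m_gt0 a0 h0; have M0 := M_gt0 h a0.
have s0 : 0 < Num.sqrt (A + B) by rewrite sqrtr_gt0.
(* Both times solve exp(m t) / sqrt(A + B) = v k, with k = m for the upper bound of the mass and k =
   M for the lower one. They are cut off at 0 because this exponential bounds the density from above
   for t <= 0 and from below for t >= 0. *)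
pose t1 := Num.min 0 (ln (v * m * Num.sqrt (A + B)) / m).
pose t2 := Num.max 0 (ln (v * M * Num.sqrt (A + B)) / m).
have t10 : t1 <= 0 by rewrite ge_min lexx.
have t20 : 0 <= t2 by rewrite le_max lexx.
have c1 : clock t1 <= v.
  apply: le_trans (mass_le a0 h0 (shift_ge0 _ A_ge0) (shift_ge0 _ B_ge0) _) _.
    exact: shift_gt0.
  rewrite ler_pdivrMr//; have D := @dens_le R a h A B t1 A_ge0 B_ge0 AB_gt0 t10.
  apply: (le_trans D).
  rewrite mulrC ler_pdivrMr// -[leRHS]lnK ?posrE ?mulr_gt0// ler_expR.
  by rewrite mulrC -ler_pdivlMr// ge_min lexx orbT.
have c2 : v <= clock t2.
  apply: le_trans (mass_ge a0 h0 (shift_ge0 _ A_ge0) (shift_ge0 _ B_ge0) _); last first.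
    exact: shift_gt0.
  rewrite ler_pdivlMr//; apply: (@le_trans _ _ ((Num.sqrt (A + B))^-1 * expR (m * t2))).
    rewrite [leRHS]mulrC ler_pdivlMr// -[leLHS]lnK ?posrE ?mulr_gt0// ler_expR.
    by rewrite [leRHS]mulrC -ler_pdivrMr// le_max lexx orbT.
  rewrite -[expR _]invrK -expRN -invfM lef_pV2 ?posrE; last 2 first.
  - by rewrite mulr_gt0 ?expR_gt0.
  - by rewrite sqrtr_gt0; exact: shift_gt0.
  rewrite -(expR_sqrt (m * t2)) -sqrtrM; last exact: ltW.
  apply: ler_wsqrtr; rewrite [leRHS]mulrDl.
  by apply: lerD; apply: ler_wpM2l => //; rewrite ler_expR lerN2 mulrA;
    apply: ler_wpM2r => //; rewrite ler_pM2l// ge_min lexx ?orbT.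
have [t _ <-] : exists2 t, t \in `[t1, t2] & clock t = v; last by exists t.
apply: IVT; first exact: le_trans t20.
  exact: continuous_subspaceT.
have c12 := le_trans c1 c2.
by rewrite (min_idPl c12) (max_idPr c12); apply/andP.
Qed.

(** The clock takes exactly the positive values; the default 0 is met only for v <= 0. *)
Definition unclock (v : R) : R := xget 0 [set t | clock t = v].

Let clockK : cancel clock unclock.
Proof.
by move=> t; exact: clock_inj (@xgetI _ 0 [set u | clock u = clock t] t erefl).
Qed.

Let unclockK v : 0 < v -> clock (unclock v) = v.
Proof. by move=> /clock_surj[t <-]; rewrite clockK. Qed.

Let is_derive_unclock (v : R) : 0 < v ->
  is_derive v 1 unclock (Num.sqrt (rad a h A B (unclock v))).
Proof.
move=> v0; have := @is_derive_inverse _ clock unclock _ (unclock v) _ _ (is_derive_clock _).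
rewrite unclockK// /dens invrK; apply.
- by near=> t; exact: clockK.
- by near=> t; exact: clock_cont.
- by rewrite invr_eq0 gt_eqF// sqrtr_gt0 rad_gt0.
Unshelve. all: by end_near. Qed.

Definition growth (t : R) : R := expR (2 * beta * t).
(** The reading that the clock must show at time t. The formulas below describe a solution as long
    as this reading is positive. *)
Definition target (t : R) : R := mass a h A B + (growth t - 1) / beta.
Definition slow_time (t : R) : R := unclock (target t).
(** [rad_sum] and [rad_diff] are x + w and x - w along the orbit. The second is not taken as a
    square root, since B has lost the sign of x0 - w0, which the orbit keeps. *)
Definition rad_sum (t : R) : R := growth t * Num.sqrt (rad a h A B (slow_time t)).
Definition rad_diff (t : R) : R := (x0 - w0) * (growth t * expR (- (a * slow_time t))).
Definition sol_x (t : R) : R := (rad_sum t + rad_diff t) / 2.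
Definition sol_w (t : R) : R := (rad_sum t - rad_diff t) / 2.

Let growth_gt0 t : 0 < growth t. Proof. exact: expR_gt0. Qed.

Let is_derive_growth (t : R) : is_derive t 1 growth (2 * beta * growth t).
Proof.
have := is_derive_expR_comp (is_derive_scalel (2 * beta) t).
by move=> /is_derive_eq; apply; rewrite mulrC.
Qed.

Let is_derive_slow (t : R) : 0 < target t -> is_derive t 1 slow_time (2 * rad_sum t).
Proof.
move=> t0.
have dT : is_derive t 1 target (2 * growth t).
  have := is_derive_addr (is_derive_const (mass a h A B) t)
    (is_derive_cstl beta^-1 (is_derive_addr (is_derive_growth t) (is_derive_const (-1) t))).
  rewrite /target; under eq_fun do rewrite /= [_ * (_ - _)]mulrC.
  by move=> /is_derive_eq; apply; field; rewrite gt_eqF.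
have := is_derive1_comp (is_derive_unclock t0) dT.
by move=> /is_derive_eq; apply; rewrite /rad_sum /slow_time; ring.
Qed.

Let is_derive_rad_sum (t : R) : 0 < target t ->
  is_derive t 1 rad_sum (2 * beta * rad_sum t - 2 * h * (4 * sol_x t * sol_w t)
                        - 2 * a * rad_diff t ^+ 2).
Proof.
move=> t0; have ds := is_derive_slow t0.
have r0 : 0 < rad a h A B (slow_time t) by rewrite rad_gt0.
have dr := is_derive1_comp (is_derive_rad a h A B (slow_time t)) ds.
have := is_derive_mulr (is_derive_growth t) 
  (@is_derive_sqrt_comp _ (fun u => rad a h A B (slow_time u)) t _ r0 dr).
move=> /is_derive_eq; apply => /=.
have S2 := sqr_sqrtr (ltW r0).
have S0 : Num.sqrt (rad a h A B (slow_time t)) != 0 by rewrite gt_eqF// sqrtr_gt0.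
rewrite /sol_x /sol_w.
have -> : 4 * ((rad_sum t + rad_diff t) / 2) * ((rad_sum t - rad_diff t) / 2) =
  rad_sum t ^+ 2 - rad_diff t ^+ 2 by field.
rewrite /rad_sum /rad_diff !exprMn S2.
have -> : expR (- (a * slow_time t)) ^+ 2 = expR (- (2 * a * slow_time t)).
  by rewrite expr2 -expRD; congr expR; ring.
rewrite /rad; set S := Num.sqrt _ in S0 *; rewrite -/B; field.
by rewrite S0.
Qed.

Let is_derive_rad_diff (t : R) : 0 < target t ->
  is_derive t 1 rad_diff (2 * beta * rad_diff t - 2 * a * rad_sum t * rad_diff t).
Proof.
move=> t0; have ds := is_derive_slow t0.
have := is_derive_cstl (x0 - w0) (is_derive_mulr (is_derive_growth t)
  (is_derive_expR_comp (is_derive_cstl (- a) ds))).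
rewrite /rad_diff; under eq_fun do rewrite mulNr.
by move=> /is_derive_eq; apply; rewrite mulNr /rad_diff; ring.
Qed.

Lemma is_derive_sol_x (t : R) : 0 < target t ->
  is_derive t 1 sol_x (2 * sol_x t * (beta - a * sol_x t + (a - 2 * h) * sol_w t)).
Proof.
move=> t0.
have := is_derive_cstl 2^-1 (is_derive_addr (is_derive_rad_sum t0) (is_derive_rad_diff t0)).
rewrite /sol_x; under eq_fun do rewrite mulrC.
by move=> /is_derive_eq; apply; rewrite /sol_w; field.
Qed.

Lemma is_derive_sol_w (t : R) : 0 < target t ->
  is_derive t 1 sol_w (2 * sol_w t * (beta + (a - 2 * h) * sol_x t - a * sol_w t)).
Proof.
move=> t0.
have := is_derive_cstl 2^-1 (is_derive_addr (is_derive_rad_sum t0)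
  (is_derive_cstl (-1) (is_derive_rad_diff t0))).
rewrite /sol_w; under eq_fun do rewrite mulN1r mulrC.
by move=> /is_derive_eq; apply; rewrite /sol_x; field.
Qed.

Let rad_sumE t : rad_sum t ^+ 2 = growth t ^+ 2 * rad a h A B (slow_time t).
Proof. by rewrite /rad_sum exprMn sqr_sqrtr// ltW// rad_gt0. Qed.

Let rad_diffE t :
  rad_diff t ^+ 2 = growth t ^+ 2 * (B * expR (- (2 * a * slow_time t))).
Proof.
rewrite /rad_diff !exprMn /B.
have -> : expR (- (a * slow_time t)) ^+ 2 = expR (- (2 * a * slow_time t)).
  by rewrite expr2 -expRD; congr expR; ring.
ring.
Qed.

Let rad_sum_gt0 t : 0 < rad_sum t.
Proof. by rewrite mulr_gt0// sqrtr_gt0 rad_gt0. Qed.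

Lemma sol_mul t :
  4 * sol_x t * sol_w t = growth t ^+ 2 * (A * expR (- (2 * h * slow_time t))).
Proof.
rewrite /sol_x /sol_w.
have -> : 4 * ((rad_sum t + rad_diff t) / 2) * ((rad_sum t - rad_diff t) / 2) =
  rad_sum t ^+ 2 - rad_diff t ^+ 2 by field.
by rewrite rad_sumE rad_diffE /rad; ring.
Qed.

Lemma sol_diff t :
  (sol_x t - sol_w t) ^+ 2 = growth t ^+ 2 * (B * expR (- (2 * a * slow_time t))).
Proof. by rewrite -rad_diffE /sol_x /sol_w; congr (_ ^+ 2); field. Qed.

Lemma sol_add_gt0 t : 0 < sol_x t + sol_w t.
Proof.
have -> : sol_x t + sol_w t = rad_sum t by rewrite /sol_x /sol_w; field.
exact: rad_sum_gt0.
Qed.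

Let diff_le_sum t : `|rad_diff t| <= rad_sum t.
Proof.
rewrite -[leRHS]ger0_norm; last exact/ltW/rad_sum_gt0.
rewrite -!sqrtr_sqr; apply: ler_wsqrtr.
rewrite rad_diffE rad_sumE ler_wpM2l ?sqr_ge0// /rad lerDr.
by rewrite mulr_ge0 ?expR_ge0.
Qed.

Lemma sol_x_ge0 t : 0 <= sol_x t.
Proof. by have := diff_le_sum t; rewrite ler_norml /sol_x => /andP[? ?]; lra. Qed.

Lemma sol_w_ge0 t : 0 <= sol_w t.
Proof. by have := diff_le_sum t; rewrite ler_norml /sol_w => /andP[? ?]; lra. Qed.

Let sol_sub t : sol_x t - sol_w t = rad_diff t.
Proof. by rewrite /sol_x /sol_w; field. Qed.

(** By [sol_mul] the product of the two coordinates vanishes exactly when it does initially. In that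
    case the conserved sign of x - w tells which coordinate is zero, the sum being positive. *)
Lemma sol_x_gt0 t : (0 < sol_x t) = (0 < x0).
Proof.
have k : 0 < growth t * expR (- (a * slow_time t)) by rewrite mulr_gt0// expR_gt0.
have := sol_mul t; have := sol_sub t; have := sol_add_gt0 t.
have := sol_x_ge0 t; have := sol_w_ge0 t; rewrite /rad_diff /A.
set X := sol_x t; set W := sol_w t => W0 X0 XW0 D P.
have [x1|] := ltP 0 x0; last first.
  move=> x1'; have x1 : x0 = 0 by apply/eqP; rewrite eq_le x1' x0_ge0.
  move: P D; rewrite x1 ?mulr0 ?mul0r ?mulr0 ?sub0r ?subr0 ?mulNr => P D.
  have w1 : 0 < w0 by move: s0_gt0; rewrite x1 add0r.
  have := mulr_gt0 w1 k => wk.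
  have W1 : 0 < W.
    have -> : W = X + w0 * (growth t * expR (- (a * slow_time t))).
      by rewrite -[RHS]opprK opprD -D; ring.
    by rewrite ltr_wpDl.
  apply/negbTE; rewrite -leNgt leNgt; apply/negP => X1.
  have : 0 < 4 * X * W by apply: mulr_gt0 => //; apply: mulr_gt0.
  by rewrite P ltxx.
rewrite lt_neqAle X0 andbT; apply/eqP => X1.
move: P; rewrite -X1 mulr0 mul0r => /esym/eqP.
rewrite mulf_eq0 sqrf_eq0 gt_eqF//= mulf_eq0 [expR _ == 0]gt_eqF ?expR_gt0// orbF.
rewrite !mulf_eq0 pnatr_eq0/= gt_eqF//= => /eqP w1.
by move: D; rewrite w1 -X1 => D; nra.
Qed.

Lemma sol_w_gt0 t : (0 < sol_w t) = (0 < w0).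
Proof.
have k : 0 < growth t * expR (- (a * slow_time t)) by rewrite mulr_gt0// expR_gt0.
have := sol_mul t; have := sol_sub t; have := sol_add_gt0 t.
have := sol_x_ge0 t; have := sol_w_ge0 t; rewrite /rad_diff /A.
set X := sol_x t; set W := sol_w t => W0 X0 XW0 D P.
have [x1|] := ltP 0 w0; last first.
  move=> x1'; have x1 : w0 = 0 by apply/eqP; rewrite eq_le x1' w0_ge0.
  move: P D; rewrite x1 ?mulr0 ?mul0r ?mulr0 ?sub0r ?subr0 ?mulNr => P D.
  have w1 : 0 < x0 by move: s0_gt0; rewrite x1 addr0.
  have := mulr_gt0 w1 k => wk.
  have X1 : 0 < X.
    have -> : X = W + x0 * (growth t * expR (- (a * slow_time t))).
      by rewrite -D; ring.
    by rewrite ltr_wpDl.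
  apply/negbTE; rewrite -leNgt leNgt; apply/negP => W1.
  have : 0 < 4 * X * W by apply: mulr_gt0 => //; apply: mulr_gt0.
  by rewrite P ltxx.
rewrite lt_neqAle W0 andbT; apply/eqP => X1.
move: P; rewrite -X1 mulr0 => /esym/eqP.
rewrite mulf_eq0 sqrf_eq0 gt_eqF//= mulf_eq0 [expR _ == 0]gt_eqF ?expR_gt0// orbF.
rewrite !mulf_eq0 pnatr_eq0/= (gt_eqF x1) orbF => /eqP w1.
by move: D; rewrite w1 -X1 => D; nra.
Qed.

(** By homogeneity the factor [growth] comes out of the mass, and what is left is the clock at
    [slow_time t], that is [target t], which is affine in [growth t]. *)
Lemma mass_sol t : 0 < target t ->
  beta * mass a h (4 * sol_x t * sol_w t) ((sol_x t - sol_w t) ^+ 2) =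
  1 + (beta * mass a h A B - 1) / growth t.
Proof.
move=> t0; rewrite sol_mul sol_diff mass_scale//; last first.
- exact: shift_gt0.
- exact: shift_ge0.
- exact: shift_ge0.
have -> : mass a h (A * expR (- (2 * h * slow_time t))) (B * expR (- (2 * a * slow_time t))) =
  target t by rewrite -[RHS]unclockK.
by rewrite /target; field; rewrite !gt_eqF.
Qed.

Lemma growth0 : growth 0 = 1. Proof. by rewrite /growth mulr0 expR0. Qed.

Let slow_time0 : slow_time 0 = 0.
Proof. by rewrite /slow_time /target growth0 subrr mul0r addr0 -clock0 clockK. Qed.

Let rad_sum0 : rad_sum 0 = x0 + w0.
Proof.
by rewrite /rad_sum slow_time0 growth0 mul1r rad0 AB sqrtr_sqr gtr0_norm.
Qed.

Let rad_diff0 : rad_diff 0 = x0 - w0.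
Proof. by rewrite /rad_diff slow_time0 growth0 mulr0 oppr0 expR0 !mulr1. Qed.

Lemma sol_x0 : sol_x 0 = x0.
Proof. by rewrite /sol_x rad_sum0 rad_diff0; field. Qed.

Lemma sol_w0 : sol_w 0 = w0.
Proof. by rewrite /sol_w rad_sum0 rad_diff0; field. Qed.

Lemma target_gt0 t : 0 <= t -> 0 < target t.
Proof.
move=> t0; apply: ltr_pwDl; first exact: mass_gt0.
apply: divr_ge0; last exact: ltW.
by rewrite subr_ge0 -[leLHS]expR0 ler_expR !mulr_ge0// ltW.
Qed.

(** beta * target = (beta * mass - 1) + growth, so at gauge at least 1 the reading stays positive at
    all negative times as well. *)
Lemma target_gt0_back t : 1 <= beta * mass a h A B -> 0 < target t.
Proof.
move=> f1; rewrite -(pmulr_rgt0 _ b0) /target mulrDr mulrCA divff ?gt_eqF// mulr1.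
by rewrite addrA subr_gt0 (le_lt_trans f1)// ltrDl growth_gt0.
Qed.

End RadialSolution.

(** * The gauge on the quadrant of radii *)

Section Gauge.
Variables (R : realType) (a h beta : R).
Hypotheses (a0 : 0 < a) (h0 : 0 < h) (b0 : 0 < beta).
Implicit Types (r : R * R) (c : R).

Definition gauge r : R :=
  beta * mass a h (4 * r.1 ^+ 2 * r.2 ^+ 2) ((r.1 ^+ 2 - r.2 ^+ 2) ^+ 2).

Definition sqnorm r : R := r.1 ^+ 2 + r.2 ^+ 2.

Lemma sqnorm_ge0 r : 0 <= sqnorm r.
Proof. by rewrite addr_ge0// sqr_ge0. Qed.

Let A_ge0 r : 0 <= 4 * r.1 ^+ 2 * r.2 ^+ 2.
Proof. by apply: mulr_ge0; [apply: mulr_ge0 => //|]; exact: sqr_ge0. Qed.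

Let AB r : 4 * r.1 ^+ 2 * r.2 ^+ 2 + (r.1 ^+ 2 - r.2 ^+ 2) ^+ 2 = sqnorm r ^+ 2.
Proof. by rewrite /sqnorm; ring. Qed.

Let sqrtAB r :
  Num.sqrt (4 * r.1 ^+ 2 * r.2 ^+ 2 + (r.1 ^+ 2 - r.2 ^+ 2) ^+ 2) = sqnorm r.
Proof. by rewrite AB sqrtr_sqr ger0_norm// sqnorm_ge0. Qed.

Let AB_gt0 r : 0 < sqnorm r ->
  0 < 4 * r.1 ^+ 2 * r.2 ^+ 2 + (r.1 ^+ 2 - r.2 ^+ 2) ^+ 2.
Proof. by move=> r0; rewrite AB exprn_gt0. Qed.

Lemma gauge_gt0 r : 0 < sqnorm r -> 0 < gauge r.
Proof. by move=> r0; rewrite mulr_gt0// mass_gt0// ?sqr_ge0// AB_gt0. Qed.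

Lemma gauge_le r : 0 < sqnorm r -> gauge r * sqnorm r <= beta / Num.min a h.
Proof.
move=> r0; rewrite /gauge -mulrA ler_pM2l// -ler_pdivlMr// [leRHS]mulrC.
have := mass_le a0 h0 (A_ge0 r) (sqr_ge0 (r.1 ^+ 2 - r.2 ^+ 2)) (AB_gt0 r0).
by rewrite sqrtAB.
Qed.

Lemma gauge_scale c r : 0 < c -> 0 < sqnorm r ->
  gauge (c * r.1, c * r.2) = gauge r / c ^+ 2.
Proof.
move=> c0 r0; have c20 : 0 < c ^+ 2 by rewrite exprn_gt0.
rewrite /gauge /=.
have -> : 4 * (c * r.1) ^+ 2 * (c * r.2) ^+ 2 =
  (c ^+ 2) ^+ 2 * (4 * r.1 ^+ 2 * r.2 ^+ 2) by ring.
have -> : ((c * r.1) ^+ 2 - (c * r.2) ^+ 2) ^+ 2 =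
  (c ^+ 2) ^+ 2 * (r.1 ^+ 2 - r.2 ^+ 2) ^+ 2 by ring.
rewrite mass_scale//; last exact: AB_gt0; last exact: sqr_ge0.
by rewrite mulrCA mulrC.
Qed.

Lemma gauge_axis1 c : 0 < c -> gauge (c, 0) = beta / (a * c ^+ 2).
Proof.
move=> c0; rewrite /gauge /= expr0n /= mulr0 subr0 mass_0B ?exprn_gt0//.
by rewrite sqrtr_sqr gtr0_norm ?exprn_gt0// -[_^-1 / a]invfM [_ * a]mulrC.
Qed.

Lemma gauge_axis2 c : 0 < c -> gauge (0, c) = beta / (a * c ^+ 2).
Proof.
move=> c0; rewrite /gauge /= expr0n /= mulr0 mul0r sub0r sqrrN mass_0B ?exprn_gt0//.
by rewrite sqrtr_sqr gtr0_norm ?exprn_gt0// -[_^-1 / a]invfM [_ * a]mulrC.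
Qed.

Lemma gauge_diag c : 0 < c -> gauge (c, c) = beta / (2 * h * c ^+ 2).
Proof.
move=> c0; have c2 : 0 < 2 * c ^+ 2 by rewrite mulr_gt0// exprn_gt0.
have -> : gauge (c, c) = beta * mass a h ((2 * c ^+ 2) ^+ 2) 0.
  rewrite /gauge.
  have -> : ((c, c).1 ^+ 2 - (c, c).2 ^+ 2) ^+ 2 = 0 by rewrite /= subrr expr0n.
  by have -> : 4 * (c, c).1 ^+ 2 * (c, c).2 ^+ 2 = (2 * c ^+ 2) ^+ 2 by rewrite /=; ring.
rewrite mass_A0 ?exprn_gt0// sqrtr_sqr gtr0_norm//.
by rewrite -[_^-1 / h]invfM; congr (_ / _); ring.
Qed.

(** Homogeneity separates the size [sqnorm r] from the ratio Z, which lies in [0, 1]; continuity of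
    the gauge thereby becomes a question about one real parameter. *)
Lemma gauge_clamp r : 0 < sqnorm r ->
  let Z := ((r.1 ^+ 2 - r.2 ^+ 2) / sqnorm r) ^+ 2 in
  gauge r = beta * ((sqnorm r)^-1 * mass a h (1 - clamp Z) (clamp Z)).
Proof.
move=> r0 Z; have Z0 : 0 <= Z by rewrite sqr_ge0.
have E2 : sqnorm r ^+ 2 * Z = (r.1 ^+ 2 - r.2 ^+ 2) ^+ 2.
  by rewrite /Z exprMn exprVn mulrCA divff ?mulr1// gt_eqF// exprn_gt0.
have E1 : sqnorm r ^+ 2 * (1 - Z) = 4 * r.1 ^+ 2 * r.2 ^+ 2.
  by rewrite mulrBr mulr1 E2 -AB addrK.
have Z1 : 0 <= 1 - Z by rewrite -(pmulr_rge0 _ (exprn_gt0 2 r0)) E1.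
have Zc : clamp Z = Z by apply: clamp_id; rewrite Z0 -subr_ge0.
rewrite Zc -(@mass_scale _ a h a0 h0 (sqnorm r) (1 - Z) Z) ?subrK//.
by rewrite E1 E2.
Qed.

Lemma continuous_sqnorm : continuous sqnorm.
Proof.
move=> r; apply: cvgD; apply: cvgM; (exact: cvg_fst || exact: cvg_snd).
Qed.

Lemma continuous_gauge r : 0 < sqnorm r -> {for r, continuous gauge}.
Proof.
move=> r0; rewrite /prop_for /continuous_at gauge_clamp//.
pose Z (r : R * R) := ((r.1 ^+ 2 - r.2 ^+ 2) / sqnorm r) ^+ 2.
pose mc Z := mass a h (1 - clamp Z) (clamp Z).
pose G (r : R * R) := beta * ((sqnorm r)^-1 * mc (Z r)).
have cV : (sqnorm x)^-1 @[x --> r] --> (sqnorm r)^-1.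
  by apply: cvgV; [rewrite gt_eqF|exact: continuous_sqnorm].
have cZ : {for r, continuous Z}.
  have c1 : (x.1 ^+ 2 - x.2 ^+ 2) / sqnorm x @[x --> r] -->
    (r.1 ^+ 2 - r.2 ^+ 2) / sqnorm r.
    apply: cvgM => //; apply: cvgB; apply: cvgM; (exact: cvg_fst || exact: cvg_snd).
  exact: (cvgM c1 c1).
have cmc : mc (Z x) @[x --> r] --> mc (Z r).
  exact: (@continuous_comp (R * R)%type R R Z mc r cZ (@continuous_mass_clamp R a h a0 h0 (Z r))).
have : G x @[x --> r] --> G r by apply: cvgMl_tmp; apply: cvgM; [exact: cV|exact: cmc].
apply: cvg_trans; apply: near_eq_cvg; near=> x; rewrite /G gauge_clamp//.
by near: x; apply: (cvgr_gt (sqnorm r)) => //; exact: continuous_sqnorm.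
Unshelve. all: by end_near. Qed.

End Gauge.

(** * Topology of the phase space *)

Section ComplexTopology.
Variable R : realType.
Local Open Scope complex_scope.
Notation Re := complex.Re.
Notation Im := complex.Im.
Implicit Types (z w : R[i]) (r s : R) (y : phase R).

Lemma cmodE z : cmod z = Num.sqrt (Re z ^+ 2 + Im z ^+ 2).
Proof. by rewrite /cmod normc_def. Qed.

Lemma sqr_cmod z : cmod z ^+ 2 = Re z ^+ 2 + Im z ^+ 2.
Proof. by rewrite cmodE sqr_sqrtr// addr_ge0// sqr_ge0. Qed.

Lemma cmod_ge0 z : 0 <= cmod z.
Proof. by rewrite cmodE sqrtr_ge0. Qed.

Lemma normc_cmod z : `|z| = (cmod z)%:C.
Proof. by rewrite cmodE normc_def. Qed.

Lemma cmod_lt z (e : R[i]) : 0 < e -> (`|z| < e) = (cmod z < Re e).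
Proof. by rewrite normc_cmod !ltcE /= => /andP[/eqP-> _]; rewrite eqxx. Qed.

Lemma cmodM z w : cmod (z * w) = cmod z * cmod w.
Proof. by apply: (@complexI R); rewrite rmorphM -!normc_cmod normrM. Qed.

Lemma cmod_real r : cmod r%:C = `|r|.
Proof. by rewrite cmodE /= expr0n /= addr0 sqrtr_sqr. Qed.

Lemma cmod_cis t : cmod (cis t) = 1 :> R.
Proof. by rewrite cmodE /= cos2Dsin2 sqrtr1. Qed.

Lemma cmod_eq0 z : (cmod z == 0) = (z == 0).
Proof. by rewrite -(inj_eq (@complexI R)) -normc_cmod normr_eq0. Qed.

Lemma cmodB z w : cmod (z - w) = cmod (w - z).
Proof. by apply: (@complexI R); rewrite -!normc_cmod distrC. Qed.

Lemma cmod_triangle z w : cmod (z + w) <= cmod z + cmod w.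
Proof. by rewrite -lecR rmorphD /= -!normc_cmod ler_normD. Qed.

Lemma Re_le_cmod z : `|Re z| <= cmod z.
Proof. by rewrite -sqrtr_sqr cmodE ler_wsqrtr// lerDl sqr_ge0. Qed.

Lemma Im_le_cmod z : `|Im z| <= cmod z.
Proof. by rewrite -sqrtr_sqr cmodE ler_wsqrtr// lerDr sqr_ge0. Qed.

Lemma cmod_le_ReIm z : cmod z <= `|Re z| + `|Im z|.
Proof.
rewrite -[leRHS]ger0_norm ?addr_ge0// -sqrtr_sqr cmodE ler_wsqrtr//.
rewrite sqrrD !real_normK ?num_real// lerD2r lerDl.
by rewrite mulrn_wge0// mulr_ge0.
Qed.

Lemma cis_surj z : cmod z = 1 -> exists t, z = cis t.
Proof.
case: z => x y; rewrite cmodE /= => /(congr1 (fun s => s ^+ 2)).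
rewrite sqr_sqrtr ?addr_ge0 ?sqr_ge0// expr1n => xy.
have x1 : -1 <= x <= 1.
  by have := sqr_ge0 y => y2; apply/andP; split; nra.
have c := @acosK _ x x1; have s := sin_acos x1.
have sy : sin (acos x) = `|y| by rewrite s -sqrtr_sqr; congr Num.sqrt; lra.
have [y0|y0] := leP 0 y.
  by exists (acos x); rewrite /cis c sy ger0_norm.
by exists (- acos x); rewrite /cis cosN sinN c sy ltr0_norm// opprK.
Qed.

Lemma near_cmod (z : R[i]^o) e : 0 < e -> \forall w \near z, cmod (z - w) < e.
Proof.
move=> e0; have eC : 0 < e%:C :> R[i] by rewrite ltcR.
have := nbhsx_ballx z _ eC; apply: filterS => w.
by rewrite -ball_normE /= cmod_lt.
Qed.

Lemma cvg_cmodP (T : Type) (F : set_system T) (f : T -> R[i]^o) (z : R[i]^o) :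
  Filter F -> (forall e, 0 < e -> \forall x \near F, cmod (z - f x) < e) ->
  f @ F --> z.
Proof.
move=> FF H; apply/cvgrPdist_lt => e e0.
have e1 : 0 < Re e by move: e0; rewrite ltcE => /andP[].
by apply: filterS (H _ e1) => x; rewrite cmod_lt.
Qed.

Lemma cvg_Re (T : Type) (F : set_system T) (f : T -> R[i]^o) (z : R[i]^o) :
  Filter F -> f @ F --> z -> Re (f x) @[x --> F] --> Re z.
Proof.
move=> FF fz; apply/cvgrPdist_lt => e e0.
have : \forall x \near F, cmod (z - f x) < e := fz _ (near_cmod z e0).
by apply: filterS => x; apply: le_lt_trans; rewrite -raddfB /= Re_le_cmod.
Qed.

Lemma continuous_Re : continuous (@complex.Re R : R[i]^o -> R).
Proof. by move=> z; exact: (@cvg_Re _ (nbhs z) id z (nbhs_filter z) cvg_id). Qed.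

Lemma cvg_Im (T : Type) (F : set_system T) (f : T -> R[i]^o) (z : R[i]^o) :
  Filter F -> f @ F --> z -> Im (f x) @[x --> F] --> Im z.
Proof.
move=> FF fz; apply/cvgrPdist_lt => e e0.
have : \forall x \near F, cmod (z - f x) < e := fz _ (near_cmod z e0).
by apply: filterS => x; apply: le_lt_trans; rewrite -raddfB /= Im_le_cmod.
Qed.

Lemma continuous_Im : continuous (@complex.Im R : R[i]^o -> R).
Proof. by move=> z; exact: (@cvg_Im _ (nbhs z) id z (nbhs_filter z) cvg_id). Qed.

Lemma cvg_complex (T : Type) (F : set_system T) (f g : T -> R) (a b : R) : Filter F ->
  f @ F --> a -> g @ F --> b ->
  (fun x => f x +i* g x : R[i]^o) @ F --> (a +i* b : R[i]^o).
Proof.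
move=> FF fa gb; apply: cvg_cmodP => e e0.
have e2 : 0 < e / 2 by lra.
move/cvgrPdist_lt : fa => /(_ _ e2) fa; move/cvgrPdist_lt : gb => /(_ _ e2) gb.
apply: filterS2 fa gb => x fx gx; apply: le_lt_trans (cmod_le_ReIm _) _.
by rewrite /=; lra.
Qed.

Lemma cmod_dist z w : `|cmod z - cmod w| <= cmod (z - w).
Proof.
have := cmod_triangle (z - w) w; have := cmod_triangle (w - z) z.
by rewrite !subrK (cmodB w) ler_norml => *; apply/andP; split; lra.
Qed.

Lemma cvg_cmod (T : Type) (F : set_system T) (f : T -> R[i]^o) (z : R[i]^o) :
  Filter F -> f @ F --> z -> cmod (f x) @[x --> F] --> cmod z.
Proof.
move=> FF fz; apply/cvgrPdist_lt => e e0.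
have : \forall x \near F, cmod (z - f x) < e := fz _ (near_cmod z e0).
by apply: filterS => x; apply: le_lt_trans; exact: cmod_dist.
Qed.

Lemma continuous_cmod : continuous (@cmod R : R[i]^o -> R).
Proof. by move=> z; exact: (@cvg_cmod _ (nbhs z) id z (nbhs_filter z) cvg_id). Qed.

Lemma complex_eta z : Re z +i* Im z = z. Proof. by case: z. Qed.

Lemma cvg_mul_real (T : Type) (F : set_system T) (f : T -> R[i]^o) (g : T -> R)
    (z : R[i]^o) (b : R) : Filter F -> f @ F --> z -> g @ F --> b ->
  (fun x => f x * (g x)%:C : R[i]^o) @ F --> (z * b%:C : R[i]^o).
Proof.
move=> FF fz gb.
have E (w : R[i]) r : w * r%:C = (Re w * r) +i* (Im w * r).
  by case: w => u v; simpc.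
under eq_fun do rewrite E; rewrite E; apply: cvg_complex; apply: cvgM => //.
  exact: cvg_Re.
exact: cvg_Im.
Qed.

Lemma sqr_phase_norm y : phase_norm y ^+ 2 = cmod y.1 ^+ 2 + cmod y.2 ^+ 2.
Proof. by rewrite sqr_sqrtr// addr_ge0// sqr_ge0. Qed.

Lemma phase_norm_ge0 y : 0 <= phase_norm y.
Proof. by rewrite sqrtr_ge0. Qed.

Lemma cmod1_le_phase_norm y : cmod y.1 <= phase_norm y.
Proof. by rewrite -[leLHS]ger0_norm ?cmod_ge0// -sqrtr_sqr ler_wsqrtr// lerDl sqr_ge0. Qed.

Lemma cmod2_le_phase_norm y : cmod y.2 <= phase_norm y.
Proof. by rewrite -[leLHS]ger0_norm ?cmod_ge0// -sqrtr_sqr ler_wsqrtr// lerDr sqr_ge0. Qed.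

Lemma phase_norm_le_cmod y : phase_norm y <= cmod y.1 + cmod y.2.
Proof.
have := cmod_ge0 y.1; have := cmod_ge0 y.2 => ? ?.
rewrite -[leRHS]ger0_norm ?addr_ge0// -sqrtr_sqr /phase_norm ler_wsqrtr//.
by rewrite sqrrD lerD2r lerDl mulrn_wge0// mulr_ge0.
Qed.

Lemma phase_norm_eq0 y : (phase_norm y == 0) = (y == 0).
Proof.
rewrite -sqrf_eq0 sqr_phase_norm paddr_eq0 ?sqr_ge0// !sqrf_eq0 !cmod_eq0.
by case: y.
Qed.

Lemma phase_norm_gt0 y : (0 < phase_norm y) = (y != 0).
Proof. by rewrite lt_neqAle phase_norm_ge0 eq_sym phase_norm_eq0 andbT. Qed.

Lemma cmodN z : cmod (- z) = cmod z.
Proof. by apply: (@complexI R); rewrite -!normc_cmod normrN. Qed.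

Lemma phase_normN y : phase_norm (- y) = phase_norm y.
Proof. by case: y => u v; rewrite /phase_norm /= !cmodN. Qed.

Definition scale (c : R) y : phase R := (y.1 * c%:C, y.2 * c%:C).

Lemma phase_norm_scale c y : phase_norm (scale c y) = `|c| * phase_norm y.
Proof.
rewrite /phase_norm /= !cmodM !cmod_real !exprMn -mulrDl sqrtrM ?addr_ge0 ?sqr_ge0//.
by rewrite sqrtr_sqr normr_id mulrC.
Qed.

Lemma scaleA c d y : scale c (scale d y) = scale (d * c) y.
Proof. by rewrite /scale /= -!mulrA -!rmorphM. Qed.

Lemma scale1 y : scale 1 y = y.
Proof. by case: y => u v; rewrite /scale /= !mulr1. Qed.

Lemma cvg_phase (T : Type) (F : set_system T) (f g : T -> R[i]^o)
    (z w : R[i]^o) : Filter F -> f @ F --> z -> g @ F --> w ->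
  (fun x => (f x, g x) : phase R) @ F --> ((z, w) : phase R).
Proof.
move=> FF fz gw.
exact: (@cvg_pair T _ _ F (nbhs z) (nbhs w) FF (nbhs_filter z) (nbhs_filter w) f g fz gw).
Qed.

Lemma cvg_scale (T : Type) (F : set_system T) (f : T -> phase R) (g : T -> R) y (b : R) :
  Filter F -> f @ F --> y -> g @ F --> b ->
  (fun x => scale (g x) (f x)) @ F --> scale b y.
Proof.
move=> FF fy gb.
have f1 : (fun x => (f x).1 : R[i]^o) @ F --> (y.1 : R[i]^o).
  exact: cvg_comp fy (@cvg_fst _ _ (nbhs y.1) (nbhs y.2) _).
have f2 : (fun x => (f x).2 : R[i]^o) @ F --> (y.2 : R[i]^o).
  exact: cvg_comp fy (@cvg_snd _ _ (nbhs y.1) (nbhs y.2) _).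
exact: (cvg_phase FF (cvg_mul_real FF f1 gb) (cvg_mul_real FF f2 gb)).
Qed.

Lemma continuous_cmod1 : continuous (fun y => cmod y.1).
Proof. by move=> y; apply: continuous_comp; [exact: cvg_fst|exact: continuous_cmod]. Qed.

Lemma continuous_cmod2 : continuous (fun y => cmod y.2).
Proof. by move=> y; apply: continuous_comp; [exact: cvg_snd|exact: continuous_cmod]. Qed.

Lemma continuous_phase_norm : continuous (@phase_norm R).
Proof.
move=> y; apply: continuous_comp; last exact: sqrt_continuous.
by apply: cvgD; apply: cvgM; (exact: continuous_cmod1 || exact: continuous_cmod2).
Qed.

Lemma compact_square C : compact [set z : R[i]^o | `|Re z| <= C /\ `|Im z| <= C].
Proof.
pose f (p : R * R) : R[i]^o := p.1 +i* p.2.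
have -> : [set z : R[i]^o | `|Re z| <= C /\ `|Im z| <= C] = f @` (`[-C, C] `*` `[-C, C]).
  apply/seteqP; split=> [z [zx zy]|_ [[u v] [/= uC vC] <-]].
    exists (Re z, Im z); last exact: complex_eta.
    by split; rewrite /= in_itv /= -ler_norml.
  by move: uC vC; rewrite !in_itv /= -!ler_norml.
apply: continuous_compact.
  apply: continuous_subspaceT => p; apply: cvg_complex; [exact: cvg_fst|exact: cvg_snd].
by apply: compact_setX; exact: segment_compact.
Qed.

Lemma closed_bounded_compact (A : set (phase R)) C : closed A ->
  (forall y, A y -> phase_norm y <= C) -> compact A.
Proof.
move=> cA AC; apply: subclosed_compact cA (compact_setX (@compact_square C) (@compact_square C)) _.
move=> y /AC yC; have y1 := le_trans (cmod1_le_phase_norm y) yC.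
have y2 := le_trans (cmod2_le_phase_norm y) yC.
by split; split; apply: le_trans (_ : _ <= _) _;
  [exact: Re_le_cmod|done|exact: Im_le_cmod|done|exact: Re_le_cmod|done|exact: Im_le_cmod|done].
Qed.

Lemma compact_sphere3 : compact (sphere3 (R := R)).
Proof.
apply: (@closed_bounded_compact _ 1); last by move=> y ->.
exact: (closed_comp (fun y _ => @continuous_phase_norm y) (@closed_eq _ 1)).
Qed.

(** The factor 2 is the price of passing through the sum of the two moduli, which lies between the
    norm and twice the norm. *)
Lemma phase_norm_triangle y (w : phase R) : phase_norm (y + w) <= 2 * (phase_norm y + phase_norm w).
Proof.
have := cmod_triangle y.1 w.1; have := cmod_triangle y.2 w.2.
have := phase_norm_le_cmod (y + w).
have := cmod1_le_phase_norm y; have := cmod1_le_phase_norm w.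
have := cmod2_le_phase_norm y; have := cmod2_le_phase_norm w.
by rewrite /=; lra.
Qed.

Lemma phase_norm_ball y (U : set (phase R)) : nbhs y U ->
  exists2 e : R, 0 < e & forall w : phase R, phase_norm (y - w) < e -> U w.
Proof.
move=> [[P Q] [/= nP nQ] PQU].
have B (z : R[i]^o) (V : set R[i]^o) : nbhs z V ->
    exists2 e : R, 0 < e & forall w : R[i], cmod (z - w) < e -> V w.
  move=> /nbhs_ballP[e /= e0 eV]; exists (Re e).
    by move: e0; rewrite ltcE => /andP[].
  by move=> w zw; apply: eV; rewrite -ball_normE /= cmod_lt.
have [e e0 eP] := B _ _ nP; have [d d0 dQ] := B _ _ nQ.
exists (Num.min e d); first by rewrite lt_min e0.
move=> w; rewrite lt_min => /andP[we wd]; apply: PQU; split.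
  by apply: eP; apply: le_lt_trans we; exact: (cmod1_le_phase_norm (y - w)).
by apply: dQ; apply: le_lt_trans wd; exact: (cmod2_le_phase_norm (y - w)).
Qed.

End ComplexTopology.

(** * The flow of the reduced system *)

Section ReducedODE.
Variable R : realType.
Local Open Scope complex_scope.
Notation Re := complex.Re.
Notation Im := complex.Im.
Implicit Types (y : phase R) (t : R).

Lemma is_cderive_continuous (f : R -> R[i]^o) t d :
  is_cderive f t d -> f s @[s --> t] --> f t.
Proof.
move=> [dR dI].
have := cvg_complex (nbhs_filter t) (is_derive_continuous dR) (is_derive_continuous dI).
rewrite complex_eta; apply: cvg_trans; apply: near_eq_cvg; near=> s.
by rewrite complex_eta.
Unshelve. all: by end_near. Qed.

(** Each component of the reduced field is a real multiple of that component, so its argument is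
    constant in time and only a real factor evolves. *)
Lemma is_cderive_mul_real (z : R[i]) (q : R -> R) t k :
  is_derive t 1 q (k * q t) ->
  is_cderive (fun s => z * (q s)%:C) t (k%:C * (z * (q t)%:C)).
Proof.
have ER (w : R[i]) (r : R) : Re (w * r%:C) = Re w * r by case: w => u v /=; ring.
have EI (w : R[i]) (r : R) : Im (w * r%:C) = Im w * r by case: w => u v /=; ring.
have FR (r : R) (w : R[i]) : Re (r%:C * w) = r * Re w by case: w => u v /=; ring.
have FI (r : R) (w : R[i]) : Im (r%:C * w) = r * Im w by case: w => u v /=; ring.
move=> dq; split.
  under eq_fun do rewrite ER.
  by move: (is_derive_cstl (Re z) dq) => /is_derive_eq; apply; rewrite FR ER; ring.
under eq_fun do rewrite EI.
by move: (is_derive_cstl (Im z) dq) => /is_derive_eq; apply; rewrite FI EI; ring.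
Qed.

Lemma is_cderive_shift (f : R -> R[i]) t c d :
  is_cderive f (t + c) d -> is_cderive (fun s => f (s + c)) t d.
Proof.
have dS : is_derive t 1 (fun s : R => s + c) 1.
  by have := is_derive_addr (is_derive_id t 1) (is_derive_const c t); rewrite addr0.
move=> [dR dI]; split.
  have := @is_derive1_comp _ (fun s => Re (f s)) (fun s => s + c) t _ _ dR dS.
  by rewrite mulr1.
have := @is_derive1_comp _ (fun s => Im (f s)) (fun s => s + c) t _ _ dI dS.
by rewrite mulr1.
Qed.

Section Uniqueness.
Variables beta xi eta : R.

(** A one-sided Lipschitz estimate for the field in real coordinates, on a region where both squared
    moduli are at most N. Writing p K - p' K' as half of (p - p') (K + K') + (p + p') (K - K')
    leaves two kinds of terms: those with K + K' contribute 2 N, and those with the differences a1,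
    a2 of squared moduli contribute 4 N, hence the 6 N. *)
Lemma field_lipschitz (N p q r s p' q' r' s' K1 K2 K1' K2' : R) :
  p ^+ 2 + q ^+ 2 <= N -> r ^+ 2 + s ^+ 2 <= N ->
  p' ^+ 2 + q' ^+ 2 <= N -> r' ^+ 2 + s' ^+ 2 <= N ->
  K1 = xi * (p ^+ 2 + q ^+ 2) + eta * (r ^+ 2 + s ^+ 2) ->
  K2 = eta * (p ^+ 2 + q ^+ 2) + xi * (r ^+ 2 + s ^+ 2) ->
  K1' = xi * (p' ^+ 2 + q' ^+ 2) + eta * (r' ^+ 2 + s' ^+ 2) ->
  K2' = eta * (p' ^+ 2 + q' ^+ 2) + xi * (r' ^+ 2 + s' ^+ 2) ->
  2 * (p - p') * ((beta * p + p * K1) - (beta * p' + p' * K1')) +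
  2 * (q - q') * ((beta * q + q * K1) - (beta * q' + q' * K1')) +
  (2 * (r - r') * ((beta * r + r * K2) - (beta * r' + r' * K2')) +
  2 * (s - s') * ((beta * s + s * K2) - (beta * s' + s' * K2'))) <=
  (2 * `|beta| + 6 * N * (`|xi| + `|eta|)) *
  ((p - p') ^+ 2 + (q - q') ^+ 2 + ((r - r') ^+ 2 + (s - s') ^+ 2)).
Proof.
move=> hu1 hu2 hv1 hv2 EK1 EK2 EK1' EK2'.
pose D1 := (p - p') ^+ 2 + (q - q') ^+ 2.
pose D2 := (r - r') ^+ 2 + (s - s') ^+ 2.
pose a1 := (p - p') * (p + p') + (q - q') * (q + q').
pose a2 := (r - r') * (r + r') + (s - s') * (s + s').
have D10 : 0 <= D1 by rewrite addr_ge0// sqr_ge0.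
have D20 : 0 <= D2 by rewrite addr_ge0// sqr_ge0.
have N0 : 0 <= N by apply: le_trans hu1; rewrite addr_ge0// sqr_ge0.
(* Cauchy-Schwarz through Lagrange's identity, after the parallelogram law has bounded the squared
   modulus of the sum by 4 N. *)
have CS (x1 x2 x1' x2' : R) : x1 ^+ 2 + x2 ^+ 2 <= N -> x1' ^+ 2 + x2' ^+ 2 <= N ->
    ((x1 - x1') * (x1 + x1') + (x2 - x2') * (x2 + x2')) ^+ 2 <=
    4 * N * ((x1 - x1') ^+ 2 + (x2 - x2') ^+ 2).
  move=> h1 h2.
  have E : (x1 + x1') ^+ 2 + (x2 + x2') ^+ 2 <= 4 * N.
    have := sqr_ge0 (x1 - x1'); have := sqr_ge0 (x2 - x2'); nra.
  apply: (@le_trans _ _ (((x1 + x1') ^+ 2 + (x2 + x2') ^+ 2) *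
      ((x1 - x1') ^+ 2 + (x2 - x2') ^+ 2))).
    rewrite -subr_ge0.
    rewrite [leRHS](_ : _ = ((x1 - x1') * (x2 + x2') - (x2 - x2') * (x1 + x1')) ^+ 2).
      exact: sqr_ge0.
    by ring.
  by apply: ler_wpM2r => //; rewrite addr_ge0// sqr_ge0.
have A1 : a1 ^+ 2 <= 4 * N * D1 by exact: CS.
have A2 : a2 ^+ 2 <= 4 * N * D2 by exact: CS.
have KL k l (x z : R) : 0 <= x <= N -> 0 <= z <= N ->
    k * x + l * z <= (`|k| + `|l|) * N.
  move=> /andP[x0 xN] /andP[z0 zN]; rewrite mulrDl.
  apply: lerD.
    by apply: le_trans (ler_wpM2r x0 (ler_norm k)) _; exact: ler_wpM2l.
  by apply: le_trans (ler_wpM2r z0 (ler_norm l)) _; exact: ler_wpM2l.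
have ge0 (x z : R) : x ^+ 2 + z ^+ 2 <= N -> 0 <= x ^+ 2 + z ^+ 2 <= N.
  by move=> ->; rewrite addr_ge0// sqr_ge0.
have k1 : K1 + K1' <= 2 * ((`|xi| + `|eta|) * N).
  by have := KL xi eta _ _ (ge0 _ _ hu1) (ge0 _ _ hu2);
    have := KL xi eta _ _ (ge0 _ _ hv1) (ge0 _ _ hv2); rewrite EK1 EK1'; lra.
have k2 : K2 + K2' <= 2 * ((`|xi| + `|eta|) * N).
  by have := KL eta xi _ _ (ge0 _ _ hu1) (ge0 _ _ hu2);
    have := KL eta xi _ _ (ge0 _ _ hv1) (ge0 _ _ hv2); rewrite EK2 EK2'; lra.
rewrite [leLHS](_ : _ = 2 * beta * (D1 + D2) + ((K1 + K1') * D1 + (K2 + K2') * D2) +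
    (xi * (a1 ^+ 2 + a2 ^+ 2) + eta * (2 * a1 * a2))); last first.
  by rewrite /D1 /D2 EK1 EK2 EK1' EK2' /a1 /a2; ring.
have t1 : 2 * beta * (D1 + D2) <= 2 * `|beta| * (D1 + D2).
  by apply: ler_wpM2r; [exact: addr_ge0|rewrite ler_pM2l// ler_norm].
have t2 : (K1 + K1') * D1 + (K2 + K2') * D2 <= 2 * ((`|xi| + `|eta|) * N) * (D1 + D2).
  by rewrite [leRHS]mulrDr; apply: lerD; exact: ler_wpM2r.
have S0 : 0 <= a1 ^+ 2 + a2 ^+ 2 by rewrite addr_ge0// sqr_ge0.
have t3 : xi * (a1 ^+ 2 + a2 ^+ 2) <= `|xi| * (a1 ^+ 2 + a2 ^+ 2).
  by apply: ler_wpM2r => //; exact: ler_norm.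
have t4 : eta * (2 * a1 * a2) <= `|eta| * (a1 ^+ 2 + a2 ^+ 2).
  apply: le_trans (ler_norm _) _; rewrite normrM; apply: ler_wpM2l => //.
  rewrite ler_norml; apply/andP; split.
    by have := sqr_ge0 (a1 + a2); rewrite sqrrD; lra.
  by have := sqr_ge0 (a1 - a2); rewrite sqrrB; lra.
have t5 : (`|xi| + `|eta|) * (a1 ^+ 2 + a2 ^+ 2) <=
    (`|xi| + `|eta|) * (4 * N * (D1 + D2)).
  by apply: ler_wpM2l; [exact: addr_ge0|rewrite [leRHS]mulrDr; exact: lerD].
rewrite -/D1 -/D2.
apply: le_trans (lerD (lerD t1 t2) (lerD t3 t4)) _.
rewrite -[X in _ + X]mulrDl.
apply: le_trans (lerD (lexx _) t5) _.
by rewrite le_eqVlt; apply/orP; left; apply/eqP; ring.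
Qed.

Lemma Re_reduced1 y : Re (reduced_field beta xi eta y).1 =
  beta * Re y.1 + Re y.1 * (xi * (Re y.1 ^+ 2 + Im y.1 ^+ 2) + eta * (Re y.2 ^+ 2 + Im y.2 ^+ 2)).
Proof. by rewrite /= -!sqr_cmod; case: y => -[p q] [r s] /=; ring. Qed.

Lemma Im_reduced1 y : Im (reduced_field beta xi eta y).1 =
  beta * Im y.1 + Im y.1 * (xi * (Re y.1 ^+ 2 + Im y.1 ^+ 2) + eta * (Re y.2 ^+ 2 + Im y.2 ^+ 2)).
Proof. by rewrite /= -!sqr_cmod; case: y => -[p q] [r s] /=; ring. Qed.

Lemma Re_reduced2 y : Re (reduced_field beta xi eta y).2 =
  beta * Re y.2 + Re y.2 * (eta * (Re y.1 ^+ 2 + Im y.1 ^+ 2) + xi * (Re y.2 ^+ 2 + Im y.2 ^+ 2)).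
Proof. by rewrite /= -!sqr_cmod; case: y => -[p q] [r s] /=; ring. Qed.

Lemma Im_reduced2 y : Im (reduced_field beta xi eta y).2 =
  beta * Im y.2 + Im y.2 * (eta * (Re y.1 ^+ 2 + Im y.1 ^+ 2) + xi * (Re y.2 ^+ 2 + Im y.2 ^+ 2)).
Proof. by rewrite /= -!sqr_cmod; case: y => -[p q] [r s] /=; ring. Qed.

End Uniqueness.
End ReducedODE.

(** * Forward uniqueness of solutions *)

Section Uniqueness.
Variable R : realType.
Local Open Scope complex_scope.
Notation Re := complex.Re.
Notation Im := complex.Im.
Variables beta xi eta : R.

(** The cubic field is only locally Lipschitz, but on [0, t] both solutions are bounded by
    continuity, so Gronwall applies to their squared distance. *)
Lemma reduced_solution_unique (u v : R -> phase R) :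
  reduced_solution beta xi eta u -> reduced_solution beta xi eta v ->
  u 0 = v 0 -> forall t, 0 <= t -> u t = v t.
Proof.
move=> [cu du] [cv dv] uv0 t; rewrite le_eqVlt => /predU1P[<-//|t0].
have sub : `[0, t] `<=` `[0, +oo[.
  by move=> s /=; rewrite !in_itv /= andbT => /andP[].
have {}cu := continuous_subspaceW sub cu.
have {}cv := continuous_subspaceW sub cv.
(* The maximum of the sum of the norms bounds both solutions at once. *)
pose f s := phase_norm (u s) + phase_norm (v s).
have cf : {within `[0, t], continuous f}.
  by move=> s; apply: cvgD; apply: continuous_comp;
    [exact: cu|exact: continuous_phase_norm|exact: cv|exact: continuous_phase_norm].
have [c _ fc] := EVT_max (ltW t0) cf.
have bd (y : phase R) : phase_norm y <= f c ->
    Re y.1 ^+ 2 + Im y.1 ^+ 2 <= f c ^+ 2 /\ Re y.2 ^+ 2 + Im y.2 ^+ 2 <= f c ^+ 2.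
  move=> yc; rewrite -!sqr_cmod; split; apply: lerXn2r;
    rewrite ?nnegrE ?cmod_ge0 ?(le_trans (phase_norm_ge0 _) yc)//;
    apply: le_trans yc; [exact: cmod1_le_phase_norm|exact: cmod2_le_phase_norm].
have bdu s : 0 < s < t -> phase_norm (u s) <= f c /\ phase_norm (v s) <= f c.
  move=> /andP[s0 st]; have sI : s \in `[0, t] by rewrite in_itv /= !ltW.
  have := fc s sI.
  by rewrite {1}/f => H; split; apply: le_trans H; rewrite ?lerDl ?lerDr phase_norm_ge0.
pose d1 s := Re (u s).1 - Re (v s).1.
pose d2 s := Im (u s).1 - Im (v s).1.
pose d3 s := Re (u s).2 - Re (v s).2.
pose d4 s := Im (u s).2 - Im (v s).2.
pose w s := d1 s ^+ 2 + d2 s ^+ 2 + (d3 s ^+ 2 + d4 s ^+ 2).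
pose F y := reduced_field beta xi eta y.
pose dw s := 2 * d1 s * (Re (F (u s)).1 - Re (F (v s)).1) +
             2 * d2 s * (Im (F (u s)).1 - Im (F (v s)).1) +
            (2 * d3 s * (Re (F (u s)).2 - Re (F (v s)).2) +
             2 * d4 s * (Im (F (u s)).2 - Im (F (v s)).2)).
have ww : w t <= 0.
  apply: (@gronwall_le0 R w dw t (2 * `|beta| + 6 * f c ^+ 2 * (`|xi| + `|eta|)) t0).
  - have c1 (p : phase R -> R) : continuous p ->
        {within `[0, t], continuous (fun s => (p (u s) - p (v s)) ^+ 2)}.
      move=> cp s.
      have cd : {for s, continuous ((fun s => p (u s) - p (v s)) : subspace `[0, t] -> R)}.
        by apply: cvgB; apply: continuous_comp; [exact: cu|exact: cp|exact: cv|exact: cp].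
      exact: (cvgM cd cd).
    have r1 : continuous (fun y : phase R => Re y.1).
      by move=> y; apply: continuous_comp; [exact: cvg_fst|exact: continuous_Re].
    have r2 : continuous (fun y : phase R => Im y.1).
      by move=> y; apply: continuous_comp; [exact: cvg_fst|exact: continuous_Im].
    have r3 : continuous (fun y : phase R => Re y.2).
      by move=> y; apply: continuous_comp; [exact: cvg_snd|exact: continuous_Re].
    have r4 : continuous (fun y : phase R => Im y.2).
      by move=> y; apply: continuous_comp; [exact: cvg_snd|exact: continuous_Im].
    move=> s; apply: cvgD; apply: cvgD;
      [exact: (c1 _ r1)|exact: (c1 _ r2)|exact: (c1 _ r3)|exact: (c1 _ r4)].
  - move=> s /andP[s0 _]; have [[u1 u2] [u3 u4]] := du s s0.
    have [[v1 v2] [v3 v4]] := dv s s0.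
    by apply: is_derive_addr; apply: is_derive_addr; apply: is_derive_sqr; apply: is_derive_subr.
  - move=> s st; have [/bd[ub1 ub2] /bd[vb1 vb2]] := bdu s st.
    rewrite /dw /F !Re_reduced1 !Re_reduced2 !Im_reduced1 !Im_reduced2.
    exact: field_lipschitz.
  - by rewrite /w /d1 /d2 /d3 /d4 uv0 !subrr expr0n /= !addr0.
have {}ww : w t = 0.
  by apply/eqP; rewrite eq_le ww !addr_ge0// sqr_ge0.
move: ww => /eqP; rewrite /w !paddr_eq0 ?addr_ge0 ?sqr_ge0// !sqrf_eq0.
rewrite /d1 /d2 /d3 /d4 !subr_eq0 => /andP[/andP[/eqP e1 /eqP e2] /andP[/eqP e3 /eqP e4]].
case: (u t) (v t) e1 e2 e3 e4 => -[? ?] [? ?] [[? ?] [? ?]] /= -> -> -> ->.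
by [].
Qed.

(** By uniqueness the solution selected by [xget] agrees with any known solution having the same
    initial value. *)
Lemma flowE (u : R -> phase R) t : reduced_solution beta xi eta u -> 0 <= t ->
  flow beta xi eta t (u 0) = u t.
Proof.
move=> su t0.
pose S := [set v | reduced_solution beta xi eta v /\ v 0 = u 0].
have [sv v0] : S (xget (cst 0) S) by apply: (@xgetI _ _ S u).
exact: reduced_solution_unique.
Qed.

End Uniqueness.

(** * The flow in terms of the radial solution *)

Section ExplicitFlow.
Variables (R : realType) (a h beta : R).
Hypotheses (a0 : 0 < a) (h0 : 0 < h) (b0 : 0 < beta).
Local Open Scope complex_scope.
Implicit Types (y : phase R) (t : R).
Local Notation xs y t := (sol_x a h beta (cmod y.1 ^+ 2) (cmod y.2 ^+ 2) t).
Local Notation ws y t := (sol_w a h beta (cmod y.1 ^+ 2) (cmod y.2 ^+ 2) t).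
Local Notation ok y t := (0 < target a h beta (cmod y.1 ^+ 2) (cmod y.2 ^+ 2) t).
Local Notation G y := (gauge a h beta (collapse y)).

(* If y.1 = 0 the quotient is 0 by convention, and so is the component. *)
Definition trajectory y t : phase R :=
  (y.1 * (Num.sqrt (xs y t / cmod y.1 ^+ 2))%:C,
   y.2 * (Num.sqrt (ws y t / cmod y.2 ^+ 2))%:C).

Let sq_gt0 y : y != 0 -> 0 < cmod y.1 ^+ 2 + cmod y.2 ^+ 2.
Proof. by move=> y0; rewrite -sqr_phase_norm exprn_gt0// phase_norm_gt0. Qed.

Lemma sqr_cmod_trajectory1 y t : y != 0 -> cmod (trajectory y t).1 ^+ 2 = xs y t.
Proof.
move=> y0; rewrite cmodM cmod_real exprMn real_normK ?num_real//.
have X0 := sol_x_ge0 a h beta (sqr_ge0 (cmod y.1)) (sqr_ge0 (cmod y.2)) (sq_gt0 y0) t.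
have XE := sol_x_gt0 a h beta (sqr_ge0 (cmod y.1)) (sqr_ge0 (cmod y.2)) (sq_gt0 y0) t.
rewrite sqr_sqrtr; last by apply: divr_ge0; rewrite ?sqr_ge0.
rewrite mulrCA.
(* At a vanishing component the quotient is 0, and [sol_x_gt0] forces [sol_x] to be 0 as well. *)
have [y1|y1] := eqVneq (cmod y.1 ^+ 2) 0; last by rewrite divff// mulr1.
rewrite y1 invr0 mulr0 mulr0; apply/eqP; rewrite eq_le; move: X0 XE; rewrite y1 ltxx => ->.
by move=> /negbT; rewrite -leNgt => ->.
Qed.

Lemma sqr_cmod_trajectory2 y t : y != 0 -> cmod (trajectory y t).2 ^+ 2 = ws y t.
Proof.
move=> y0; rewrite cmodM cmod_real exprMn real_normK ?num_real//.
have X0 := sol_w_ge0 a h beta (sqr_ge0 (cmod y.1)) (sqr_ge0 (cmod y.2)) (sq_gt0 y0) t.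
have XE := sol_w_gt0 a h beta (sqr_ge0 (cmod y.1)) (sqr_ge0 (cmod y.2)) (sq_gt0 y0) t.
rewrite sqr_sqrtr; last by apply: divr_ge0; rewrite ?sqr_ge0.
rewrite mulrCA.
have [y1|y1] := eqVneq (cmod y.2 ^+ 2) 0; last by rewrite divff// mulr1.
rewrite y1 invr0 mulr0 mulr0; apply/eqP; rewrite eq_le; move: X0 XE; rewrite y1 ltxx => ->.
by move=> /negbT; rewrite -leNgt => ->.
Qed.

(** If a squared modulus X satisfies X' = 2 k X, then its square root satisfies r' = k r; a zero
    component is constant and is treated apart. *)
Let is_cderive_factor (z : R[i]) (X : R -> R) t k :
  (z != 0 -> 0 < X t) -> is_derive t 1 X (2 * X t * k) ->
  is_cderive (fun s => z * (Num.sqrt (X s / cmod z ^+ 2))%:C) t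
    (k%:C * (z * (Num.sqrt (X t / cmod z ^+ 2))%:C)).
Proof.
have [-> _ _|z0 /(_ isT) X0 dX] := eqVneq z 0.
  under eq_fun do rewrite mul0r.
  by rewrite mul0r mulr0; split; exact: is_derive_const.
apply: is_cderive_mul_real.
have cz : 0 < cmod z ^+ 2 by rewrite exprn_gt0// lt_neqAle cmod_ge0 eq_sym cmod_eq0 z0.
have q0 : 0 < X t / cmod z ^+ 2 by rewrite divr_gt0.
have dq : is_derive t 1 (fun s => X s / cmod z ^+ 2) (2 * X t * k / cmod z ^+ 2).
  have := is_derive_cstl (cmod z ^+ 2)^-1 dX.
  by under eq_fun do rewrite mulrC; move=> /is_derive_eq; apply; rewrite mulrC.
move: (@is_derive_sqrt_comp _ (fun s => X s / cmod z ^+ 2) t _ q0 dq) => /is_derive_eq; apply.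
have S2 := sqr_sqrtr (ltW q0); have S0 : Num.sqrt (X t / cmod z ^+ 2) != 0.
  by rewrite gt_eqF// sqrtr_gt0.
apply: (@mulIf _ (2 * Num.sqrt (X t / cmod z ^+ 2))); first by rewrite mulf_neq0.
rewrite divfK; last by rewrite mulf_neq0.
have -> : k * Num.sqrt (X t / cmod z ^+ 2) * (2 * Num.sqrt (X t / cmod z ^+ 2)) =
  2 * k * Num.sqrt (X t / cmod z ^+ 2) ^+ 2 by ring.
by rewrite S2; ring.
Qed.

Lemma is_cderive_trajectory y t : y != 0 -> ok y t ->
  is_cderive (fun s => (trajectory y s).1) t
    (reduced_field beta (- a) (a - 2 * h) (trajectory y t)).1 /\
  is_cderive (fun s => (trajectory y s).2) t
    (reduced_field beta (- a) (a - 2 * h) (trajectory y t)).2.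
Proof.
move=> y0 yt; rewrite /reduced_field sqr_cmod_trajectory1// sqr_cmod_trajectory2//.
have E (b k : R) (z : R[i]) : b%:C * z + z * k%:C = (b + k)%:C * z.
  by rewrite rmorphD /= mulrDl [z * _]mulrC.
rewrite !E /=.
have X0 := sol_x_gt0 a h beta (sqr_ge0 (cmod y.1)) (sqr_ge0 (cmod y.2)) (sq_gt0 y0) t.
have W0 := sol_w_gt0 a h beta (sqr_ge0 (cmod y.1)) (sqr_ge0 (cmod y.2)) (sq_gt0 y0) t.
have cz (z : R[i]) : z != 0 -> 0 < cmod z ^+ 2.
  by move=> z0; rewrite exprn_gt0// lt_neqAle cmod_ge0 eq_sym cmod_eq0 z0.
split; apply: is_cderive_factor.
- by move=> /cz; rewrite X0.
- move: (is_derive_sol_x a0 h0 b0 (sqr_ge0 (cmod y.1)) (sqr_ge0 (cmod y.2)) (sq_gt0 y0) yt).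
  by move=> /is_derive_eq; apply; ring.
- by move=> /cz; rewrite W0.
- move: (is_derive_sol_w a0 h0 b0 (sqr_ge0 (cmod y.1)) (sqr_ge0 (cmod y.2)) (sq_gt0 y0) yt).
  by move=> /is_derive_eq; apply; ring.
Qed.

Lemma trajectory0 y : y != 0 -> trajectory y 0 = y.
Proof.
move=> y0; rewrite /trajectory.
rewrite sol_x0 ?sqr_ge0 ?sq_gt0//.
rewrite sol_w0 ?sqr_ge0 ?sq_gt0//.
have E (z : R[i]) : z * (Num.sqrt (cmod z ^+ 2 / cmod z ^+ 2))%:C = z.
  have [->|z0] := eqVneq z 0; first by rewrite mul0r.
  by rewrite divff ?sqrtr1 ?mulr1// expf_neq0// cmod_eq0.
by rewrite !E; case: (y).
Qed.

(** The offset c serves two uses: c = 0 gives the semigroup itself, and a negative c gives the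
    solution that starts at an earlier point of the orbit. *)
Lemma trajectory_solution y c : y != 0 -> (forall t, 0 <= t -> ok y (t + c)) ->
  reduced_solution beta (- a) (a - 2 * h) (fun t => trajectory y (t + c)).
Proof.
move=> y0 yok.
have D t : 0 <= t ->
    is_cderive (fun s => (trajectory y (s + c)).1) t
      (reduced_field beta (- a) (a - 2 * h) (trajectory y (t + c))).1 /\
    is_cderive (fun s => (trajectory y (s + c)).2) t
      (reduced_field beta (- a) (a - 2 * h) (trajectory y (t + c))).2.
  move=> t0; have [d1 d2] := is_cderive_trajectory y0 (yok t t0).
  by split; [exact: (is_cderive_shift d1)|exact: (is_cderive_shift d2)].
split; last by move=> t /ltW; exact: D.
apply/subspace_continuousP => t; rewrite /= in_itv /= andbT => t0.
have [/is_cderive_continuous d1 /is_cderive_continuous d2] := D t t0.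
apply: cvg_within_filter.
exact: (cvg_phase (nbhs_filter t) d1 d2).
Qed.

Lemma flow_trajectory y t : y != 0 -> 0 <= t ->
  flow beta (- a) (a - 2 * h) t y = trajectory y t.
Proof.
move=> y0 t0; have yok s : 0 <= s -> ok y (s + 0).
  move=> s0; rewrite addr0.
  exact: (target_gt0 a0 h0 b0 (sqr_ge0 (cmod y.1)) (sqr_ge0 (cmod y.2)) (sq_gt0 y0) s0).
have := flowE (trajectory_solution y0 yok) t0.
by rewrite !addr0 trajectory0.
Qed.

Lemma sqnorm_collapse y : sqnorm (collapse y) = phase_norm y ^+ 2.
Proof. by rewrite sqr_phase_norm. Qed.

Lemma trajectory_neq0 y t : y != 0 -> trajectory y t != 0.
Proof.
move=> y0; rewrite -phase_norm_gt0 lt_neqAle phase_norm_ge0 andbT eq_sym -sqrf_eq0.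
rewrite sqr_phase_norm sqr_cmod_trajectory1// sqr_cmod_trajectory2// gt_eqF//.
exact: (sol_add_gt0 a h beta (sqr_ge0 (cmod y.1)) (sqr_ge0 (cmod y.2)) (sq_gt0 y0)).
Qed.

(* The gauge solves the linear equation G' = 2 beta (1 - G). *)
Lemma gauge_trajectory y t : y != 0 -> ok y t ->
  G (trajectory y t) = 1 + (G y - 1) / expR (2 * beta * t).
Proof.
move=> y0 yt.
have := mass_sol a0 h0 b0 (sqr_ge0 (cmod y.1)) (sqr_ge0 (cmod y.2)) (sq_gt0 y0) yt.
have E1 : (collapse (trajectory y t)).1 ^+ 2 = xs y t := sqr_cmod_trajectory1 t y0.
have E2 : (collapse (trajectory y t)).2 ^+ 2 = ws y t := sqr_cmod_trajectory2 t y0.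
by rewrite /gauge E1 E2.
Qed.

Lemma ok_back y t : y != 0 -> 1 <= G y -> ok y t.
Proof.
by move=> y0; exact: (target_gt0_back b0).
Qed.

(** Inside or on {G = 1} the explicit formula extends to all negative times, so a preimage under the
    semigroup is available. *)
Lemma flow_surj y t : y != 0 -> 1 <= G y -> 0 <= t ->
  flow beta (- a) (a - 2 * h) t (trajectory y (- t)) = y.
Proof.
move=> y0 Gy t0.
have := flowE (trajectory_solution y0 (fun s _ => ok_back (s - t) y0 Gy)) t0.
by rewrite add0r subrr trajectory0.
Qed.

End ExplicitFlow.

(** * The attractor *)

Section Attractor.
Variables (R : realType) (a h beta : R).
Hypotheses (a0 : 0 < a) (h0 : 0 < h) (b0 : 0 < beta).
Local Open Scope complex_scope.
Implicit Types (y : phase R) (t : R).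
Local Notation G y := (gauge a h beta (collapse y)).
Local Notation m := (Num.min a h).
Local Notation flw := (flow beta (- a) (a - 2 * h)).

Definition states : set (phase R) := [set y | y != 0 /\ G y = 1].

Definition radial y : phase R := scale (Num.sqrt (G y)) y.

Lemma sqnorm_collapse_gt0 y : y != 0 -> 0 < sqnorm (collapse y).
Proof. by move=> y0; rewrite sqnorm_collapse exprn_gt0// phase_norm_gt0. Qed.

Let G_gt0 y : y != 0 -> 0 < G y.
Proof. by move=> y0; rewrite gauge_gt0// sqnorm_collapse_gt0. Qed.

Lemma scale_neq0 c y : 0 < c -> y != 0 -> scale c y != 0.
Proof.
move=> c0 y0; rewrite -phase_norm_gt0 phase_norm_scale mulr_gt0 ?phase_norm_gt0//.
by rewrite normr_gt0 gt_eqF.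
Qed.

Lemma gauge_collapse_scale c y : 0 < c -> y != 0 -> G (scale c y) = G y / c ^+ 2.
Proof.
move=> c0 y0; rewrite -gauge_scale ?sqnorm_collapse_gt0//; congr gauge.
by rewrite /collapse /scale /= !cmodM !cmod_real gtr0_norm// ![_ * c]mulrC.
Qed.

Lemma gauge_phase_norm y : y != 0 -> G y * phase_norm y ^+ 2 <= beta / m.
Proof.
by move=> y0; rewrite -sqnorm_collapse; exact: (gauge_le a0 h0 b0 (sqnorm_collapse_gt0 y0)).
Qed.

Lemma radial_states y : y != 0 -> states (radial y).
Proof.
move=> y0; have s0 : 0 < Num.sqrt (G y) by rewrite sqrtr_gt0 G_gt0.
split; first exact: scale_neq0.
by rewrite gauge_collapse_scale// sqr_sqrtr ?ltW ?G_gt0// divff// gt_eqF ?G_gt0.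
Qed.

Lemma collapse_neq0 y : 0 < sqnorm (collapse y) -> y != 0.
Proof.
rewrite sqnorm_collapse -phase_norm_gt0 => n0.
by rewrite lt_neqAle phase_norm_ge0 andbT eq_sym -sqrf_eq0 gt_eqF.
Qed.

Lemma continuous_collapse : continuous (@collapse R).
Proof.
move=> y; apply: (@cvg_pair _ _ _ (nbhs y) (nbhs (cmod y.1)) (nbhs (cmod y.2))).
  exact: continuous_cmod1.
exact: continuous_cmod2.
Qed.

Lemma continuous_gauge_collapse y : y != 0 -> G w @[w --> y] --> G y.
Proof.
move=> y0; apply: (@continuous_comp _ _ _ (@collapse R) (gauge a h beta)).
  exact: continuous_collapse.
by apply: continuous_gauge => //; exact: sqnorm_collapse_gt0.
Qed.

Lemma continuous_radial y : y != 0 -> radial w @[w --> y] --> radial y.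
Proof.
move=> y0; apply: cvg_scale; first exact: cvg_id.
apply: (@continuous_comp _ _ _ (fun w : phase R => G w) (@Num.sqrt R)).
  exact: continuous_gauge_collapse.
exact: sqrt_continuous.
Qed.

Lemma states_sphere3 : homeomorphic states (sphere3 (R := R)).
Proof.
have s0 y : sphere3 y -> y != 0.
  by move=> y1; rewrite -phase_norm_gt0 y1 ltr01.
exists (fun y => scale (phase_norm y)^-1 y), radial; split.
- split; apply/subspace_continuousP => y.
    move=> [y0 _]; apply: cvg_within_filter; apply: cvg_scale; first exact: cvg_id.
    by apply: cvgV; [rewrite phase_norm_eq0|exact: continuous_phase_norm].
  by move=> /s0 y0; apply: cvg_within_filter; exact: continuous_radial.
- split=> _ [y hy <-]; last exact/radial_states/s0.
  case: hy => y0 _; rewrite /sphere3 /= phase_norm_scale ger0_norm ?invr_ge0 ?phase_norm_ge0//.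
  by rewrite mulVf// phase_norm_eq0.
- move=> y [y0 Gy]; have n0 : 0 < (phase_norm y)^-1 by rewrite invr_gt0 phase_norm_gt0.
  rewrite /radial gauge_collapse_scale// Gy div1r exprVn invrK sqrtr_sqr.
  rewrite ger0_norm ?phase_norm_ge0// scaleA mulVf ?scale1//.
  by rewrite phase_norm_eq0.
- move=> y hy; have y0 := s0 _ hy; rewrite /radial phase_norm_scale hy mulr1.
  rewrite ger0_norm// scaleA divff ?scale1// gt_eqF// sqrtr_gt0 G_gt0//.
Qed.

Lemma states_compact : compact states.
Proof.
have [f [g [[_ cg] [fA gB] fK gK]]] := states_sphere3.
have -> : states = g @` sphere3 (R := R).
  apply/seteqP; split=> [y Sy|]; last exact: gB.
  by exists (f y); [apply: fA; exists y|exact: fK].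
by apply: continuous_compact => //; exact: compact_sphere3.
Qed.

Lemma phase_hausdorff : hausdorff_space (phase R).
Proof. exact: norm_hausdorff. Qed.

Lemma states_closed : closed states.
Proof. exact: compact_closed phase_hausdorff states_compact. Qed.

Lemma states_small y : states y -> phase_norm y <= Num.sqrt (beta / m).
Proof.
move=> [y0 Gy]; have := gauge_phase_norm y0; rewrite Gy mul1r => H.
rewrite -[leLHS]ger0_norm ?phase_norm_ge0// -sqrtr_sqr.
exact: ler_wsqrtr.
Qed.

(** For both inclusions G - 1 is multiplied by an exponential and hence stays 0; the reverse one
    follows the orbit backward, which G = 1 allows. *)
Lemma states_invariant t : 0 <= t -> flw t @` states = states.
Proof.
move=> t0; apply/seteqP; split=> [_ [y [y0 Gy] <-]|y [y0 Gy]].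
  rewrite flow_trajectory//; split; first exact: trajectory_neq0.
  have yok : 1 <= G y by rewrite Gy.
  by rewrite gauge_trajectory//; [rewrite Gy subrr mul0r addr0|exact: ok_back].
have yok : 1 <= G y by rewrite Gy.
exists (trajectory a h beta y (- t)); last exact: flow_surj.
split; first exact: trajectory_neq0.
by rewrite gauge_trajectory//; [rewrite Gy subrr mul0r addr0|exact: ok_back].
Qed.

Lemma closed_near (A : set (phase R)) y : closed A ->
  (forall d, 0 < d -> exists z, A z /\ phase_norm (y - z) < d) -> A y.
Proof.
move=> cA H; apply: cA => B /phase_norm_ball[d d0 dB].
by have [z [Az yz]] := H d d0; exists z; split => //; exact: dB.
Qed.

Lemma away_from0 (K : set (phase R)) : compact K -> ~ K 0 ->
  exists2 e : R, 0 < e & forall y, K y -> e <= phase_norm y.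
Proof.
move=> /(compact_closed phase_hausdorff) cK K0.
have : nbhs (0 : phase R) (~` K) by apply: open_nbhs_nbhs; split => //; exact: closed_openC.
move=> /phase_norm_ball[e e0 eK]; exists e => // y Ky.
rewrite leNgt; apply/negP => ye; apply: eK Ky.
by rewrite sub0r phase_normN.
Qed.

Lemma scaleB c y : y - scale c y = scale (1 - c) y.
Proof.
case: y => u v; rewrite /scale /=.
have E (z : R[i]) : z - z * c%:C = z * (1 - c)%:C by rewrite rmorphB mulrBr mulr1.
by rewrite -!E.
Qed.

Lemma sqrt_dist1 (x : R) : 0 <= x -> `|1 - Num.sqrt x| <= `|1 - x|.
Proof.
move=> x0; have s0 := sqrtr_ge0 x.
have -> : 1 - x = (1 - Num.sqrt x) * (1 + Num.sqrt x).
  by rewrite -{1}(sqr_sqrtr x0); ring.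
rewrite normrM ler_peMr//.
by rewrite ger0_norm ?addr_ge0// lerDl.
Qed.

(** A compact set avoiding 0 has bounded gauge, so G - 1 decays exponentially and uniformly on it.
    The radial projection of the moving point lies at distance |1 - sqrt G| times its norm. *)
Lemma states_attracts (K : set (phase R)) : compact K -> ~ K 0 ->
  attracts beta (- a) (a - 2 * h) states K.
Proof.
move=> cK K0 d d0; have [e e0 eK] := away_from0 cK K0.
have m0 := m_gt0 a0 h0.
(* C bounds the gauge on K; D bounds the norm of any point whose gauge is at least 1/2. *)
pose C := beta / m / e ^+ 2; pose D := Num.sqrt (2 * (beta / m)).
have bm : 0 < beta / m by rewrite divr_gt0.
have C0 : 0 <= C by rewrite divr_ge0 ?sqr_ge0// ltW.
have D0 : 0 <= D by exact: sqrtr_ge0.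
pose X := D * (C + 1) / d.
have X0 : 0 <= X by rewrite divr_ge0 ?mulr_ge0 ?addr_ge0// ltW.
(* By exp z >= 1 + z, this time gives exp(2 beta t) >= 3 + X: the 3 keeps the gauge above 1/2, and X
   brings D (C + 1) exp(- 2 beta t) below d. *)
exists ((2 + X) / (2 * beta)); split.
  by rewrite divr_ge0 ?addr_ge0// mulr_ge0// ltW.
move=> t y tT Ky; have y0 : y != 0 by apply: contra_notN K0 => /eqP <-.
have t0 : 0 <= t by apply: le_trans tT; rewrite divr_ge0 ?addr_ge0// mulr_ge0// ltW.
have Et : 3 + X <= expR (2 * beta * t).
  apply: le_trans (expR_ge1Dx _).
  by move: tT; rewrite ler_pdivrMr ?mulr_gt0// mulrC => H; lra.
have E0 : 0 < expR (2 * beta * t) by exact: expR_gt0.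
rewrite flow_trajectory//; set Y := trajectory a h beta y t.
have Y0 : Y != 0 by exact: trajectory_neq0.
exists (radial Y); split; first exact: radial_states.
have GY : G Y = 1 + (G y - 1) / expR (2 * beta * t).
  apply: gauge_trajectory => //.
  by apply: target_gt0 => //; rewrite ?sqr_ge0// -sqr_phase_norm exprn_gt0// phase_norm_gt0.
have Gy0 := G_gt0 y0.
have GyC : G y <= C.
  rewrite /C ler_pdivlMr ?exprn_gt0//; apply: le_trans (gauge_phase_norm y0).
  by apply: ler_wpM2l; [exact: ltW|apply: lerXn2r; rewrite ?nnegrE ?phase_norm_ge0 ?eK ?ltW].
have f2 : 1 / 2 <= G Y.
  have : - (1 / 2) <= (G y - 1) / expR (2 * beta * t).
    by rewrite ler_pdivlMr//; lra.
  by rewrite GY; lra.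
have YD : phase_norm Y <= D.
  rewrite -[leLHS]ger0_norm ?phase_norm_ge0// -sqrtr_sqr; apply: ler_wsqrtr.
  have := gauge_phase_norm Y0; have := sqr_ge0 (phase_norm Y) => p2 GYn.
  have : 1 / 2 * phase_norm Y ^+ 2 <= G Y * phase_norm Y ^+ 2 by exact: ler_wpM2r.
  by lra.
rewrite scaleB phase_norm_scale.
have f1 : `|1 - Num.sqrt (G Y)| <= (C + 1) / expR (2 * beta * t).
  apply: le_trans (sqrt_dist1 (ltW (G_gt0 Y0))) _.
  rewrite GY opprD addrA subrr sub0r normrN normrM [X in _ * X]ger0_norm ?invr_ge0 ?expR_ge0//.
  apply: ler_wpM2r; first by rewrite invr_ge0 expR_ge0.
  by rewrite ler_norml; apply/andP; split; lra.
apply: le_lt_trans (ler_pM (normr_ge0 _) (phase_norm_ge0 _) f1 YD) _.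
rewrite mulrAC ltr_pdivrMr// [_ * D]mulrC.
have -> : D * (C + 1) = d * X by rewrite /X; field; rewrite gt_eqF.
by rewrite ltr_pM2l//; lra.
Qed.

Lemma states_attractor : bifurcated_attractor beta (- a) (a - 2 * h) states.
Proof.
split; [exact: states_compact|by case; rewrite eqxx|exact: states_invariant|].
exists setT; split => //; first exact: openT.
by move=> K cK K0; apply: states_attracts => // /K0[_]; apply.
Qed.

(* For [states `<=` S]: a point c y slightly inside [states] is reached at a
   large time from the level set {G = L}, which for large L lies in any given
   neighbourhood of 0. *)
Lemma states_unique (S : set (phase R)) :
  bifurcated_attractor beta (- a) (a - 2 * h) S -> states = S.
Proof.
move=> [cS S0 iS [U [oU U0 SU US]]].
have clS : closed S by exact: compact_closed phase_hausdorff cS.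
have m0 := m_gt0 a0 h0.
have bm : 0 < beta / m by rewrite divr_gt0.
apply/seteqP; split=> y; last first.
  (* S is itself a compact set avoiding 0, hence attracted by [states]; being invariant, it equals
     its own image at the time T, so it lies within every d of the closed set [states]. *)
  move=> Sy; apply: closed_near states_closed _ => d d0.
  have [T [T0 TS]] := states_attracts cS S0 d0.
  move: (Sy); rewrite -(iS T T0) => -[y' Sy' <-].
  exact: TS.
move=> Sy; have [y0 Gy] := Sy.
have [e e0 eU] : exists2 e : R, 0 < e & forall w, phase_norm (0 - w) < e -> U w.
  by apply: phase_norm_ball; exact: open_nbhs_nbhs.
(* On {G = L} the squared norm is at most beta / (m L), which this L puts below e^2; the summand 1
   makes the inequality strict. *)
pose L := 1 + beta / m / e ^+ 2.
have L1 : 0 < L - 1 by rewrite /L addrAC subrr add0r divr_gt0// exprn_gt0.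
have L0 : 0 < L by lra.
pose K : set (phase R) := scale (Num.sqrt L)^-1 @` states.
have sL : 0 < (Num.sqrt L)^-1 by rewrite invr_gt0 sqrtr_gt0.
have KP w : K w <-> w != 0 /\ G w = L.
  split=> [[z [z0 Gz] <-]|[w0 Gw]].
    split; first exact: scale_neq0.
    by rewrite gauge_collapse_scale// Gz exprVn invrK mul1r sqr_sqrtr// ltW.
  exists (radial w); first exact: radial_states.
  by rewrite /radial scaleA Gw divff ?scale1// gt_eqF// sqrtr_gt0.
have cK : compact K.
  apply: continuous_compact; last exact: states_compact.
  apply: continuous_subspaceT => w; apply: cvg_scale; [exact: cvg_id|exact: cvg_cst].
have KU : K `<=` U `\ 0.
  move=> w /KP[w0 Gw]; split; last by apply/eqP.
  apply: eU; rewrite sub0r phase_normN.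
  rewrite -[ltLHS]ger0_norm ?phase_norm_ge0// -[ltRHS]ger0_norm ?ltW//.
  rewrite -!sqrtr_sqr ltr_sqrt ?exprn_gt0//.
  have := gauge_phase_norm w0; rewrite Gw -ler_pdivlMl// => /le_lt_trans; apply.
  rewrite ltr_pdivrMl// -ltr_pdivrMr ?exprn_gt0// /L; lra.
apply: closed_near clS _ => d d0.
(* Two errors below d / 4, doubled by [phase_norm_triangle], add up to less than d. *)
have d4 : 0 < d / 4 by rewrite divr_gt0.
have [T0 [T00 TS]] := US K cK KU (d / 4) d4.
pose X := 4 * (L - 1) * phase_norm y / d.
have X0 : 0 <= X by rewrite divr_ge0 ?mulr_ge0 ?phase_norm_ge0// ltW.
pose t := T0 + X / (2 * beta).
have tT : T0 <= t by rewrite lerDl divr_ge0// mulr_ge0// ltW.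
have t0 : 0 <= t by exact: le_trans tT.
have Et : 1 + X <= expR (2 * beta * t).
  apply: le_trans (expR_ge1Dx _); rewrite lerD2l /t mulrDr.
  rewrite [X in _ + X](_ : _ = X); last by field; rewrite gt_eqF.
  by rewrite lerDr !mulr_ge0// ltW.
have E0 : 0 < expR (2 * beta * t) by exact: expR_gt0.
(* Following the orbit back for a time t multiplies G - 1 by exp(2 beta t), so q is the level that
   comes from L; scaling y by c = 1 / sqrt q moves it from level 1 to level q. *)
pose q := 1 + (L - 1) / expR (2 * beta * t).
have q1 : 1 < q by rewrite ltrDl divr_gt0.
have q0 : 0 < q by exact: lt_trans q1.
pose c := (Num.sqrt q)^-1.
have sq1 : 1 <= Num.sqrt q by rewrite -sqrtr1; apply: ler_wsqrtr; exact: ltW.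
have sq0 : 0 < Num.sqrt q by exact: lt_le_trans sq1.
have c0 : 0 < c by rewrite invr_gt0.
have yc0 : scale c y != 0 by exact: scale_neq0.
have Gyc : G (scale c y) = q.
  by rewrite gauge_collapse_scale// Gy exprVn invrK mul1r sqr_sqrtr// ltW.
have Gyc1 : 1 <= G (scale c y) by rewrite Gyc ltW.
have Kk : K (trajectory a h beta (scale c y) (- t)).
  apply/KP; split; first exact: trajectory_neq0.
  rewrite gauge_trajectory//; last exact: ok_back.
  by rewrite Gyc mulrN expRN invrK /q addrAC subrr add0r divfK ?gt_eqF// addrC subrK.
have [z [Sz]] := TS t _ tT Kk; rewrite flow_surj// => zd.
exists z; split => //.
rewrite -(subrK (scale c y) y) -addrA.
apply: le_lt_trans (phase_norm_triangle _ _) _.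
suff : phase_norm (y - scale c y) < d / 4 by move=> ?; lra.
rewrite scaleB phase_norm_scale.
have c1 : `|1 - c| <= (L - 1) / expR (2 * beta * t).
  rewrite ger0_norm; last by rewrite subr_ge0 invf_le1.
  (* For s = sqrt q >= 1 one has 1 - 1/s <= s - 1 <= s^2 - 1. *)
  apply: (@le_trans _ _ (q - 1)); last by rewrite /q addrAC subrr add0r.
  rewrite -(sqr_sqrtr (ltW q0)) /c.
  apply: (@le_trans _ _ (Num.sqrt q - 1)).
    rewrite lerBlDr; have := mulfV (lt0r_neq0 sq0); nra.
  nra.
apply: le_lt_trans (ler_wpM2r (phase_norm_ge0 _) c1) _.
rewrite mulrAC ltr_pdivrMr//.
have -> : (L - 1) * phase_norm y = d / 4 * X by rewrite /X; field; rewrite gt_eqF.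
by rewrite ltr_pM2l//; lra.
Qed.

End Attractor.

(** * Arc, circles and torus *)

Section Generated.
Variable R : realType.
Local Open Scope complex_scope.
Implicit Types (r : R) (p : R * R) (y : phase R).

Let factor_cont r : continuous (fun z : R[i]^o => z * r%:C : R[i]^o).
Proof.
move=> z; have := cvg_mul_real (nbhs_filter z) (@cvg_id _ (nbhs z)) (@cvg_cst R r _ (nbhs z) _).
exact.
Qed.

Let fst_cont : continuous (fun y : phase R => y.1 : R[i]^o).
Proof. by move=> y; exact: cvg_fst. Qed.

Let snd_cont : continuous (fun y : phase R => y.2 : R[i]^o).
Proof. by move=> y; exact: cvg_snd. Qed.

Let factorK r (z : R[i]) : 0 < r -> z * r%:C * (r^-1)%:C = z.
Proof. by move=> r0; rewrite -mulrA -rmorphM /= divff ?mulr1// gt_eqF. Qed.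

Lemma generated_circle2 r : 0 < r -> is_circle (generated_set (0, r)).
Proof.
move=> r0.
exists (fun z => (0, z * r%:C)), (fun y => y.2 * (r^-1)%:C); split.
- split; apply: continuous_subspaceT => z.
    exact: (cvg_phase (nbhs_filter z) (@cvg_cst R[i]^o 0 _ (nbhs z) _) (@factor_cont r z)).
  exact: (@continuous_comp _ _ _ (fun y : phase R => y.2 : R[i]^o) _ z
    (snd_cont (x:=z)) (@factor_cont r^-1 _)).
- split=> [_ [z /= /cis_surj[t ->] <-]|_ [_ [t1 [t2 ->]] <-]].
    by exists 0, t; rewrite mul0r mulrC.
  by rewrite /= [r%:C * _]mulrC factorK// /circle /= cmod_cis.
- by move=> z _ /=; rewrite factorK.
- move=> _ [t1 [t2 ->]] /=; rewrite [r%:C * _]mulrC factorK//.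
  by rewrite mul0r.
Qed.

Lemma generated_circle1 r : 0 < r -> is_circle (generated_set (r, 0)).
Proof.
move=> r0.
exists (fun z => (z * r%:C, 0)), (fun y => y.1 * (r^-1)%:C); split.
- split; apply: continuous_subspaceT => z.
    exact: (cvg_phase (nbhs_filter z) (@factor_cont r z) (@cvg_cst R[i]^o 0 _ (nbhs z) _)).
  exact: (@continuous_comp _ _ _ (fun y : phase R => y.1 : R[i]^o) _ z
    (fst_cont (x:=z)) (@factor_cont r^-1 _)).
- split=> [_ [z /= /cis_surj[t ->] <-]|_ [_ [t1 [t2 ->]] <-]].
    by exists t, 0; rewrite mul0r mulrC.
  by rewrite /= [r%:C * _]mulrC factorK// /circle /= cmod_cis.
- by move=> z _ /=; rewrite factorK.
- move=> _ [t1 [t2 ->]] /=; rewrite [r%:C * _]mulrC factorK//.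
  by rewrite mul0r.
Qed.

Lemma generated_torus r : 0 < r -> is_torus (generated_set (r, r)).
Proof.
move=> r0; exists (scale r), (scale r^-1); split.
- by split; apply: continuous_subspaceT => z; apply: cvg_scale; (exact: cvg_id || exact: cvg_cst).
- split=> [_ [[z w] [/= /cis_surj[t1 ->] /cis_surj[t2 ->]] <-]|_ [_ [t1 [t2 ->]] <-]].
    by exists t1, t2; rewrite /scale /= ![r%:C * _]mulrC.
  by rewrite /scale /= ![r%:C * _]mulrC !factorK//; split; rewrite /circle /= cmod_cis.
- by move=> y _; rewrite scaleA mulrV ?scale1// unitfE gt_eqF.
- by move=> y _; rewrite scaleA mulVr ?scale1// unitfE gt_eqF.
Qed.

Lemma collapse_generated p y : 0 <= p.1 -> 0 <= p.2 -> generated_set p y ->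
  collapse y = p.
Proof.
move=> p1 p2 [t1 [t2 ->]]; rewrite /collapse /= !cmodM !cmod_cis !mulr1 !cmod_real.
by rewrite !ger0_norm//; case: p {p1 p2}.
Qed.

(** The reduced field commutes with independent rotations of the two components, so a zero of the
    collapsed field lifts to all arguments. *)
Lemma generated_steady beta xi eta p y : 0 <= p.1 -> 0 <= p.2 ->
  collapsed_field beta xi eta p = (0, 0) -> generated_set p y ->
  reduced_field beta xi eta y = (0, 0).
Proof.
move=> p1 p2 [E1 E2] py; have := collapse_generated p1 p2 py.
move=> Ep; have e1 : cmod y.1 = p.1 by rewrite -Ep.
have e2 : cmod y.2 = p.2 by rewrite -Ep.
rewrite /reduced_field e1 e2; move: py => [t1 [t2 ->]] /=.
have E (b q k : R) (z : R[i]) :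
    b%:C * (q%:C * z) + q%:C * z * k%:C = (b * q + q * k)%:C * z.
  by rewrite rmorphD !rmorphM /=; ring.
by rewrite !E E1 E2 !mul0r.
Qed.

End Generated.

(** * The collapsed attractor and its fixed points *)

Section CollapsedStates.
Variables (R : realType) (a h beta : R).
Hypotheses (a0 : 0 < a) (h0 : 0 < h) (b0 : 0 < beta).
Local Open Scope complex_scope.
Local Notation g := (gauge a h beta).

Definition collapsed_states : set (R * R) :=
  [set r | [/\ 0 <= r.1, 0 <= r.2, 0 < sqnorm r & g r = 1]].

Lemma collapse_states : @collapse R @` states a h beta = collapsed_states.
Proof.
apply/seteqP; split=> [_ [y [y0 Gy] <-]|[r1 r2] [/= r10 r20 r0 gr]].
  by split; rewrite ?cmod_ge0//; exact: sqnorm_collapse_gt0.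
have E : collapse (r1%:C : R[i]^o, r2%:C : R[i]^o) = (r1, r2).
  by rewrite /collapse /= !cmod_real !ger0_norm.
by exists (r1%:C, r2%:C) => //; split; [apply: collapse_neq0|]; rewrite E.
Qed.

Let dir (t : R) : R * R := (1 - t, t).
Let dir_gt0 t : 0 < sqnorm (dir t).
Proof.
(* This form is positive for every real t, so the parametrisation below is continuous on the whole
   line and not only on [0, 1]. *)
rewrite /sqnorm /dir /= (_ : _ + _ = 2^-1 * (1 + (1 - 2 * t) ^+ 2)); last by field.
by rewrite mulr_gt0// ltr_pwDl// sqr_ge0.
Qed.

(** Each ray of the quadrant meets {g = 1} exactly once. The segment from (1, 0) to (0, 1)
    parametrises the rays, the factor sqrt g pushes it onto the level set, and r2 / (r1 + r2)
    recovers the ray. *)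
Lemma collapsed_states_arc : is_arc collapsed_states.
Proof.
pose c t := Num.sqrt (g (dir t)).
have c0 t : 0 < c t by rewrite sqrtr_gt0 gauge_gt0.
exists (fun t => (c t * (1 - t), c t * t)), (fun r => r.2 / (r.1 + r.2)).
have S0 r : collapsed_states r -> 0 < r.1 + r.2.
  move=> [r1 r2 r0 _]; rewrite lt_neqAle addr_ge0// andbT eq_sym paddr_eq0//.
  apply/negP => /andP[/eqP e1 /eqP e2]; move: r0; rewrite /sqnorm e1 e2 expr0n /= addr0.
  by rewrite ltxx.
split.
- split.
    apply: continuous_subspaceT => t.
    have cd : dir s @[s --> t] --> dir t.
      apply: (@cvg_pair _ _ _ (nbhs t) (nbhs (1 - t)) (nbhs t)); last exact: cvg_id.
      by apply: cvgB; [exact: cvg_cst|exact: cvg_id].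
    have cc : c s @[s --> t] --> c t.
      apply: (@continuous_comp _ _ _ (fun s => g (dir s)) (@Num.sqrt R)).
        apply: (@continuous_comp _ _ _ dir g) => //.
        by apply: continuous_gauge => //; exact: dir_gt0.
      exact: sqrt_continuous.
    apply: (@cvg_pair _ _ _ (nbhs t) (nbhs (c t * (1 - t))) (nbhs (c t * t))).
      by apply: cvgM => //; apply: cvgB; [exact: cvg_cst|exact: cvg_id].
    by apply: cvgM => //; exact: cvg_id.
  apply/subspace_continuousP => r /S0 r0; apply: cvg_within_filter.
  apply: cvgM; first exact: cvg_snd.
  apply: cvgV; first by rewrite gt_eqF.
  by apply: cvgD; [exact: cvg_fst|exact: cvg_snd].
- split=> [_ [t /= + <-]|_ [r Sr <-]].
    rewrite in_itv /= => /andP[t0 t1].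
    have gE := @gauge_scale R a h beta a0 h0 _ _ (c0 t) (dir_gt0 t).
    split.
    + by apply: mulr_ge0; [exact/ltW/c0|rewrite subr_ge0].
    + by apply: mulr_ge0 => //; exact/ltW/c0.
    + have -> : sqnorm (c t * (1 - t), c t * t) = c t ^+ 2 * sqnorm (dir t).
        by rewrite /sqnorm /=; ring.
      by rewrite mulr_gt0// exprn_gt0.
    + rewrite gE /c sqr_sqrtr; last by rewrite ltW// gauge_gt0.
      by rewrite divff// gt_eqF// gauge_gt0.
  have r0 := S0 _ Sr; move: Sr => [r1 r2 _ _]; rewrite /= in_itv /=.
  by apply/andP; split; [exact: divr_ge0 (ltW r0)|rewrite ler_pdivrMr// mul1r lerDr].
- move=> t _ /=; rewrite -mulrDr subrK mulr1 mulrAC divff ?mul1r// gt_eqF//.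
- move=> r Sr; have r0 := S0 _ Sr; move: Sr => [r1 r2 q0 gr].
  set s := r.1 + r.2 in r0 *.
  have s1 : 0 < s^-1 by rewrite invr_gt0.
  have dE : dir (r.2 / s) = (s^-1 * r.1, s^-1 * r.2).
    by rewrite /dir /s; congr (_, _); field; rewrite gt_eqF.
  have -> : c (r.2 / s) = s.
    by rewrite /c dE gauge_scale// gr mul1r exprVn invrK sqrtr_sqr gtr0_norm.
  rewrite [RHS]surjective_pairing /s; congr (_, _); field; rewrite gt_eqF//.
Qed.

Lemma generated_states p y : collapsed_states p -> generated_set p y ->
  states a h beta y.
Proof.
move=> [p1 p2 p0 gp] /(collapse_generated p1 p2) E; split; last by rewrite E.
by apply: collapse_neq0; rewrite E.
Qed.

Lemma collapsed_states_axis1 : collapsed_states (Num.sqrt (beta / a), 0).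
Proof.
have r0 : 0 < Num.sqrt (beta / a) by rewrite sqrtr_gt0 divr_gt0.
have r2 : Num.sqrt (beta / a) ^+ 2 = beta / a by rewrite sqr_sqrtr// ltW// divr_gt0.
split; [exact: sqrtr_ge0|exact: lexx| |].
  by rewrite /sqnorm /= expr0n addr0 exprn_gt0.
by rewrite gauge_axis1// r2; field; rewrite !gt_eqF.
Qed.

Lemma collapsed_states_axis2 : collapsed_states (0, Num.sqrt (beta / a)).
Proof.
have r0 : 0 < Num.sqrt (beta / a) by rewrite sqrtr_gt0 divr_gt0.
have r2 : Num.sqrt (beta / a) ^+ 2 = beta / a by rewrite sqr_sqrtr// ltW// divr_gt0.
split; [exact: lexx|exact: sqrtr_ge0| |].
  by rewrite /sqnorm /= expr0n add0r exprn_gt0.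
by rewrite gauge_axis2// r2; field; rewrite !gt_eqF.
Qed.

Lemma collapsed_states_diag :
  collapsed_states (Num.sqrt (beta / (2 * h)), Num.sqrt (beta / (2 * h))).
Proof.
have q0 : 0 < beta / (2 * h) by rewrite divr_gt0// mulr_gt0.
have r0 : 0 < Num.sqrt (beta / (2 * h)) by rewrite sqrtr_gt0.
have r2 : Num.sqrt (beta / (2 * h)) ^+ 2 = beta / (2 * h) by rewrite sqr_sqrtr// ltW.
split; [exact: sqrtr_ge0|exact: sqrtr_ge0| |].
  by rewrite /sqnorm /= addr_gt0// exprn_gt0.
by rewrite gauge_diag// r2; field; rewrite !gt_eqF.
Qed.

Lemma collapsed_field_axis1 eta :
  collapsed_field beta (- a) eta (Num.sqrt (beta / a), 0) = (0, 0).
Proof.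
rewrite /collapsed_field /= sqr_sqrtr; last by rewrite ltW// divr_gt0.
by congr (_, _); field; rewrite gt_eqF.
Qed.

Lemma collapsed_field_axis2 eta :
  collapsed_field beta (- a) eta (0, Num.sqrt (beta / a)) = (0, 0).
Proof.
rewrite /collapsed_field /= sqr_sqrtr; last by rewrite ltW// divr_gt0.
by congr (_, _); field; rewrite gt_eqF.
Qed.

Lemma collapsed_field_diag :
  collapsed_field beta (- a) (a - 2 * h)
    (Num.sqrt (beta / (2 * h)), Num.sqrt (beta / (2 * h))) = (0, 0).
Proof.
rewrite /collapsed_field /= sqr_sqrtr; last by rewrite ltW// divr_gt0// mulr_gt0.
by congr (_, _); field; rewrite gt_eqF.
Qed.

End CollapsedStates.

(** * The lattice and the signs of the coefficients *)

Section Lattice.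
Variables (R : realType) (l1 l2 k1 k2 : 'rV[R]_2).
Hypotheses (k1l1 : dotp k1 l1 = 2 * pi) (k1l2 : dotp k1 l2 = 0).
Hypotheses (k2l1 : dotp k2 l1 = 0) (k2l2 : dotp k2 l2 = 2 * pi).
Implicit Types (u v : 'rV[R]_2) (n p q : int * int).
Local Notation dual := (dual_vec k1 k2).

Lemma dotpDl u v w : dotp (u + v) w = dotp u w + dotp v w.
Proof.
by rewrite /dotp -big_split /=; apply: eq_bigr => i _; rewrite mxE mulrDl.
Qed.

Lemma dotpMzl u v (z : int) : dotp (u *~ z) v = dotp u v * z%:~R.
Proof.
rewrite /dotp mulr_suml; apply: eq_bigr => i _.
by rewrite -scaler_int mxE; ring.
Qed.

Lemma dotp_ge0 u : 0 <= dotp u u.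
Proof. by rewrite sumr_ge0// => i _; rewrite -expr2 sqr_ge0. Qed.

Lemma sqr_enorm u : enorm u ^+ 2 = dotp u u.
Proof. by rewrite sqr_sqrtr// dotp_ge0. Qed.

Lemma enorm_ge0 u : 0 <= enorm u. Proof. exact: sqrtr_ge0. Qed.

Lemma enorm_gt0 u : u != 0 -> 0 < enorm u.
Proof.
move=> u0; rewrite lt_neqAle enorm_ge0 andbT eq_sym -sqrf_eq0 sqr_enorm.
apply: contra u0 => /eqP; rewrite /dotp => /psumr_eq0P H.
apply/eqP/rowP => i; rewrite mxE; apply/eqP.
have := H (fun i _ => _) i isT; rewrite -expr2 => /(_ _)/eqP.
by rewrite sqrf_eq0; apply => j; rewrite -expr2 sqr_ge0.
Qed.

Lemma enorm_double u : enorm (u + u) = 2 * enorm u.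
Proof.
have -> : u + u = u *~ 2 by rewrite -mulr2n.
rewrite /enorm (_ : dotp _ _ = 2 ^+ 2 * dotp u u).
  by rewrite sqrtrM ?sqr_ge0// sqrtr_sqr ger0_norm.
rewrite /dotp mulr_sumr; apply: eq_bigr => i _.
by rewrite -scaler_int mxE; ring.
Qed.

(** Pairing with l1 and l2 recovers the two integer coefficients up to the factor 2 pi. *)
Lemma dual_vec_neq0 n : n != (0, 0) -> dual n != 0.
Proof.
move=> n0; apply: contra n0 => /eqP d0.
have pi0 : 2 * pi != 0 :> R by rewrite mulf_neq0// gt_eqF// pi_gt0.
have e1 : dotp (dual n) l1 = 2 * pi * n.1%:~R.
  by rewrite dotpDl !dotpMzl k1l1 k2l1 mul0r addr0.
have e2 : dotp (dual n) l2 = 2 * pi * n.2%:~R.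
  by rewrite dotpDl !dotpMzl k1l2 k2l2 mul0r add0r.
have z w : dotp (0 : 'rV[R]_2) w = 0.
  by rewrite /dotp big1// => i _; rewrite mxE mul0r.
move: e1 e2; rewrite d0 !z => /esym/eqP + /esym/eqP.
rewrite ![2 * pi * _ == 0]mulf_eq0 !(negbTE pi0) !intr_eq0 /= => /eqP e1 /eqP e2.
by rewrite [n]surjective_pairing e1 e2.
Qed.

Lemma dual_vecB p q : dual p - dual q = dual (p.1 - q.1, p.2 - q.2).
Proof. by rewrite /dual_vec /= !mulrzBr; rewrite opprD addrACA. Qed.

Lemma critical_neq0 p : critical_indices k1 k2 p -> p != (0, 0).
Proof. by case. Qed.

(** Minimality gives the weak inequality. In case of equality p - q would be critical too, hence one
    of p, -p, q, -q: this makes p or q zero, or one of them twice the other, which contradicts the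
    equality of the minimal norms. It keeps the denominators of eta positive. *)
Lemma critical_sub_gt p q : critical_indices k1 k2 p -> critical_indices k1 k2 q ->
  p != q ->
  (forall r, critical_indices k1 k2 r ->
     [\/ r = p, r = (- p.1, - p.2), r = q | r = (- q.1, - q.2)]) ->
  0 < enorm (dual p - dual q) ^+ 2 - enorm (dual p) ^+ 2.
Proof.
move=> cp cq pq C; rewrite dual_vecB.
set r := (p.1 - q.1, p.2 - q.2).
have r0 : r != (0, 0).
  apply: contra pq => /eqP[/eqP + /eqP]; rewrite !subr_eq0 => /eqP e1 /eqP e2.
  by rewrite [p]surjective_pairing [q]surjective_pairing e1 e2.
have p0 := enorm_gt0 (dual_vec_neq0 (critical_neq0 cp)).
have q0 := enorm_gt0 (dual_vec_neq0 (critical_neq0 cq)).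
have pr : enorm (dual p) <= enorm (dual r) by exact: cp.2.
rewrite subr_gt0 ltr_pXn2r ?nnegrE ?enorm_ge0//.
rewrite lt_neqAle pr andbT; apply/eqP => E.
have cr : critical_indices k1 k2 r by split => // m m0; rewrite -E; exact: cp.2.
have nz n : critical_indices k1 k2 n -> n.1 = 0 -> n.2 = 0 -> False.
  by move=> /critical_neq0 /eqP n0 e1 e2; apply: n0; rewrite [n]surjective_pairing e1 e2.
have dbl n n' : critical_indices k1 k2 n -> critical_indices k1 k2 n' ->
    n'.1 = n.1 + n.1 -> n'.2 = n.2 + n.2 -> False.
  move=> cn cn' e1 e2; have := cn'.2 n (critical_neq0 cn).
  have -> : dual n' = dual n + dual n.
    by rewrite /dual_vec e1 e2 !mulrzDr addrACA.
  rewrite enorm_double; have := enorm_gt0 (dual_vec_neq0 (critical_neq0 cn)).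
  lra.
have [] := C _ cr => Er; have e1 := congr1 fst Er; have e2 := congr1 snd Er;
  rewrite /= in e1 e2.
- by apply: (nz q) => //; lia.
- by apply: (dbl p q) => //; lia.
- by apply: (dbl q p) => //; lia.
- by apply: (nz p) => //; lia.
Qed.

End Lattice.

(** After multiplication by 9 e, the second entry of the maximum yields exactly xi < 0 and the first
    exactly xi + eta < 0. *)
Lemma coef_signs (R : realFieldType) (e c d gamma2 gamma3 : R) :
  0 < e -> 0 < c -> 0 < d ->
  2 / 9 * Num.max (1 / (3 * e) + 2 / c + 2 / d) (1 / e) * gamma2 ^+ 2 < gamma3 ->
  (2 * gamma2 ^+ 2 - 9 * e * gamma3) / 3 < 0 /\
  (2 * gamma2 ^+ 2 - 9 * e * gamma3) / 3 +
  2 * e * (2 * gamma2 ^+ 2 / c + 2 * gamma2 ^+ 2 / d - 3 * gamma3) < 0.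
Proof.
move=> e0 c0 d0 H.
have M (x : R) : x <= Num.max (1 / (3 * e) + 2 / c + 2 / d) (1 / e) ->
    9 * e * (2 / 9 * x * gamma2 ^+ 2) < 9 * e * gamma3.
  move=> xM; rewrite ltr_pM2l ?mulr_gt0//; apply: le_lt_trans H.
  by rewrite ler_wpM2r ?sqr_ge0// ler_wpM2l.
split.
  have := M (1 / e); rewrite le_max lexx orbT => /(_ isT).
  have -> : 9 * e * (2 / 9 * (1 / e) * gamma2 ^+ 2) = 2 * gamma2 ^+ 2.
    by field; rewrite gt_eqF.
  by lra.
have := M (1 / (3 * e) + 2 / c + 2 / d); rewrite le_max lexx => /(_ isT).
set L := (X in X < _ -> _) => LH.
suff -> : (2 * gamma2 ^+ 2 - 9 * e * gamma3) / 3 +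
  2 * e * (2 * gamma2 ^+ 2 / c + 2 * gamma2 ^+ 2 / d - 3 * gamma3) =
  L - 9 * e * gamma3 by rewrite subr_lt0.
by rewrite /L; field; rewrite !gt_eqF.
Qed.

(** If n were m or -m, the four listed indices would reduce to n and -n, too few for a set of four
    elements. *)
Lemma card4_neq (n m : int * int) (C : set (int * int)) : (C #= `I_4)%card ->
  C = [set n; (- n.1, - n.2); m; (- m.1, - m.2)] ->
  n <> m /\ n <> (- m.1, - m.2).
Proof.
move=> C4 CE.
have small : ~ C `<=` [set n; (- n.1, - n.2)].
  move=> sub; pose f (i : nat) := if i == 0%N then n else (- n.1, - n.2).
  have sub' : C `<=` f @` `I_2.
    by move=> x /sub[->|->]; [exists 0%N|exists 1%N].
  have := card_le_trans (subset_card_le sub') (card_image_le _ _).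
  by rewrite (card_le_eql C4) card_le_II.
split=> E; apply: small; rewrite CE -?E => x [[[->|->]|->]|->]; rewrite -?E /=; auto.
  by right; rewrite E /= !opprK -surjective_pairing.
Qed.

Unset Implicit Arguments.

Theorem theorem5p1 (R : realType) (l1 l2 k1 k2 : 'rV[R]_2)
    (n1 n2 n3 n4 : int) (gamma2 gamma3 : R) :
  free [:: l1; l2] ->
  dotp k1 l1 = 2 * pi -> dotp k1 l2 = 0 ->
  dotp k2 l1 = 0 -> dotp k2 l2 = 2 * pi ->
  (critical_indices k1 k2 #= `I_4)%card ->
  critical_indices k1 k2 =
    [set (n1, n2); (- n1, - n2); (n3, n4); (- n3, - n4)] ->
  0 < gamma3 ->
  let kc1 := dual_vec k1 k2 (n1, n2) in
  let kc2 := dual_vec k1 k2 (n3, n4) in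
  threshold kc1 kc2 * gamma2 ^+ 2 < gamma3 ->
  let lambda0 := enorm kc1 ^+ 2 in
  let xi := coef_xi kc1 gamma2 gamma3 in
  let eta := coef_eta kc1 kc2 gamma2 gamma3 in
  exists Sigma : R -> set (phase R),
    (forall d : R, 0 < d -> \forall lambda \near lambda0^'+,
       forall y, Sigma lambda y -> phase_norm y < d) /\
    \forall lambda \near lambda0^'+,
      let beta := coef_beta kc1 lambda in
      let p1 := (0, Num.sqrt (- beta / xi)) in
      let p2 := (Num.sqrt (- beta / xi), 0) in
      let p3 := (Num.sqrt (- beta / (xi + eta)),
                 Num.sqrt (- beta / (xi + eta))) in
      let Sigma_r := @collapse R @` Sigma lambda in
      [/\ unique (bifurcated_attractor beta xi eta) (Sigma lambda)
          /\ homological_to R (Sigma lambda) (sphere3 (R := R)),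
          is_arc Sigma_r
          /\ Sigma_r `<=` [set r | 0 <= r.1 /\ 0 <= r.2],
          [/\ Sigma_r p1 /\ collapsed_field beta xi eta p1 = (0, 0),
              Sigma_r p2 /\ collapsed_field beta xi eta p2 = (0, 0) &
              xi ^+ 2 <> eta ^+ 2 ->
                Sigma_r p3 /\ collapsed_field beta xi eta p3 = (0, 0)],
          [/\ is_circle (generated_set p1),
              is_circle (generated_set p2) &
              is_torus (generated_set p3)] &
          forall p, p \in [:: p1; p2; p3] ->
            forall y, generated_set p y ->
              reduced_field beta xi eta y = (0, 0) /\ Sigma lambda y].
Proof.
move=> _ k1l1 k1l2 k2l1 k2l2 C4 CE _ kc1 kc2 thr lambda0 xi eta.
have [nm nm'] := card4_neq (n := (n1, n2)) (m := (n3, n4)) C4 CE.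
have crit r : critical_indices k1 k2 r ->
    [\/ r = (n1, n2), r = (- n1, - n2), r = (n3, n4) | r = (- n3, - n4)].
  by rewrite CE => -[[[->|->]|->]|->]; [apply: Or41|apply: Or42|apply: Or43|apply: Or44].
have cn : critical_indices k1 k2 (n1, n2) by rewrite CE; left; left; left.
have cm : critical_indices k1 k2 (n3, n4) by rewrite CE; left; right.
have cm' : critical_indices k1 k2 (- n3, - n4) by rewrite CE; right.
have sub_gt0 : 0 < enorm (kc1 - kc2) ^+ 2 - enorm kc1 ^+ 2.
  by apply: (critical_sub_gt k1l1 k1l2 k2l1 k2l2 cn cm) => //; apply/eqP.
have add_gt0 : 0 < enorm (kc1 + kc2) ^+ 2 - enorm kc1 ^+ 2.
  (* The sum is a difference with the opposite critical vector, so the same lemma covers it. *)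
  have -> : kc1 + kc2 = kc1 - dual_vec k1 k2 (- n3, - n4).
    by rewrite /kc2 /dual_vec /= !mulrNz -opprD opprK.
  apply: (critical_sub_gt k1l1 k1l2 k2l1 k2l2 cn cm'); first exact/eqP.
  move=> r /crit[->|->|->|->] /=; rewrite ?opprK;
    by [apply: Or41|apply: Or42|apply: Or44|apply: Or43].
have e0 : 0 < lambda0.
  by rewrite exprn_gt0// enorm_gt0// (dual_vec_neq0 k1l1 k1l2 k2l1 k2l2)// (critical_neq0 cn).
have [xi0 xe0] : xi < 0 /\ xi + eta < 0 := coef_signs e0 sub_gt0 add_gt0 thr.
pose a := - xi; pose h := - (xi + eta) / 2.
have a0 : 0 < a by rewrite oppr_gt0.
have h0 : 0 < h by rewrite divr_gt0// oppr_gt0.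
have m0 := m_gt0 a0 h0.
have betaE lambda : coef_beta kc1 lambda = lambda0 * (lambda - lambda0).
  by rewrite /coef_beta /lambda0; ring.
have beta_gt0 lambda : lambda0 < lambda -> 0 < coef_beta kc1 lambda.
  by move=> ll; rewrite betaE mulr_gt0// subr_gt0.
exists (fun lambda => states a h (coef_beta kc1 lambda)); split.
  move=> d d0; near=> lambda => y.
  have b0 : 0 < coef_beta kc1 lambda.
    by apply: beta_gt0; near: lambda; exact: nbhs_right_gt.
  move=> /(states_small a0 h0 b0) /le_lt_trans; apply.
  (* The states lie in the ball of radius sqrt(beta / m), where beta = lambda0 (lambda - lambda0)
     and m is independent of lambda; so lambda - lambda0 < d^2 m / lambda0 suffices. *)
  rewrite -[ltRHS]ger0_norm ?ltW// -sqrtr_sqr ltr_sqrt ?exprn_gt0//.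
  rewrite ltr_pdivrMr// betaE mulrC -ltr_pdivlMr// ltrBlDl.
  near: lambda; apply: nbhs_right_lt.
  by rewrite ltrDl divr_gt0// mulr_gt0// exprn_gt0.
near=> lambda; set beta := coef_beta kc1 lambda.
set p1 := (0, Num.sqrt (- beta / xi)); set p2 := (Num.sqrt (- beta / xi), 0).
set p3 := (Num.sqrt (- beta / (xi + eta)), Num.sqrt (- beta / (xi + eta))).
have b0 : 0 < beta.
  by apply: beta_gt0; near: lambda; exact: nbhs_right_gt.
have xiE : xi = - a by rewrite /a opprK.
have etaE : eta = a - 2 * h by rewrite /a /h; field.
have q1 : - beta / xi = beta / a by rewrite xiE invrN mulrNN.
have q3 : - beta / (xi + eta) = beta / (2 * h).
  have -> : 2 * h = - (xi + eta) by rewrite /h; field.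
  by rewrite invrN mulrN mulNr.
have r1 : 0 < Num.sqrt (beta / a) by rewrite sqrtr_gt0 divr_gt0.
have r3 : 0 < Num.sqrt (beta / (2 * h)) by rewrite sqrtr_gt0 divr_gt0// mulr_gt0.
have S1 : collapsed_states a h beta p1 by rewrite /p1 q1; exact: collapsed_states_axis2.
have S2 : collapsed_states a h beta p2 by rewrite /p2 q1; exact: collapsed_states_axis1.
have S3 : collapsed_states a h beta p3 by rewrite /p3 q3; exact: collapsed_states_diag.
have F1 : collapsed_field beta xi eta p1 = (0, 0).
  by rewrite /p1 q1 xiE; exact: collapsed_field_axis2.
have F2 : collapsed_field beta xi eta p2 = (0, 0).
  by rewrite /p2 q1 xiE; exact: collapsed_field_axis1.
have F3 : collapsed_field beta xi eta p3 = (0, 0).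
  by rewrite /p3 q3 etaE xiE; exact: collapsed_field_diag.
rewrite collapse_states//.
split.
- split; last exact/homeomorphic_homological/states_sphere3.
  rewrite etaE xiE; split; first exact: states_attractor.
  by move=> S; exact: states_unique.
- split; first exact: collapsed_states_arc.
  by move=> r [].
- by [].
- rewrite /p1 /p2 /p3 q1 q3; split.
  + exact: generated_circle2.
  + exact: generated_circle1.
  + exact: generated_torus.
- move=> p; rewrite !inE => /or3P[] /eqP -> y py; split.
  + by apply: (generated_steady _ _ F1 py); rewrite /= ?sqrtr_ge0.
  + exact: generated_states S1 py.
  + by apply: (generated_steady _ _ F2 py); rewrite /= ?sqrtr_ge0.
  + exact: generated_states S2 py.
  + by apply: (generated_steady _ _ F3 py); rewrite /= ?sqrtr_ge0.
  + exact: generated_states S3 py.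
Unshelve. all: by end_near. Qed.
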